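(* Let $\mathbf{X}$ be a represented space. The following are equivalent: (1) $\mathbf{X}$ is a computably discrete computably Quasi-Polish space. (2) There is an equivalence relation $R$ on $\mathbb{N}$ such that $\mathbb{N}/R$ is computably admissible and $\mathbf{X}$ is computably isomorphic to $\mathbb{N}/R$. (3) There is a computably enumerable equivalence relation (ceer) $R$ on $\mathbb{N}$ such that $\mathbf{X}$ is computably isomorphic to $\mathbb{N}/R$.
   Context: A represented space $\mathbf{X}=(X,\delta_{\mathbf{X}})$ is a set $X$ with a partial surjection $\delta_{\mathbf{X}}:\subseteq\mathbb{N}^{\mathbb{N}}\to X$; any $p$ with $\delta_{\mathbf X}(p)=x$ is a name of $x$. A realiser of a map $f:\mathbf{X}\to\mathbf{Y}$ is a partial map $R_f:\subseteq\mathbb{N}^{\mathbb{N}}\to\mathbb{N}^{\mathbb{N}}$ sending every name of every $x\in X$ to a name of $f(x)$; $f$ is computable (continuously realisable) if it has a computable (continuous) realiser. A computable isomorphism is a computable bijection with computable inverse. $\mathbb{N}$ is represented by $\delta_{\mathbb N}(p)=p(0)$. $\mathbf{Y}^{\mathbf{X}}$ is the represented space of total continuously realisable functions; a name of $f$ is a $p\in\mathbb N^{\mathbb N}$ coding a realiser of $f$, with $p(0)$ the index of a Turing machine using the oracle $n\mapsto p(n+1)$. In the product $\mathbf{X}\times\mathbf{Y}$, $p$ names $(x,y)$ iff $n\mapsto p(2n)$ names $x$ and $n\mapsto p(2n+1)$ names $y$. Sierpinski space $\mathbb{S}=\{\top,\bot\}$ is represented so that $0^\omega$ names $\bot$ and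 every other sequence names $\top$. The space $\mathcal{O}(\mathbf{X})$ of open sets is $\mathbb{S}^{\mathbf{X}}$, identifying $U$ with its characteristic function ($x\mapsto\top$ iff $x\in U$); $U$ is computably open if it is a computable point of $\mathcal O(\mathbf X)$ (i.e. has a computable name). $\mathbf{X}$ is computably discrete if the diagonal of $\mathbf X\times\mathbf X$ is computably open, i.e. equality is semidecidable. $\mathbf{X}$ is computably admissible if the map $\mathbf{X}\to\mathcal{O}(\mathcal{O}(\mathbf{X}))$, $x\mapsto\{U\in\mathcal{O}(\mathbf{X})\mid x\in U\}$, has a computable partial inverse (defined on its image). $\mathbf{X}$ is computably overt if non-emptiness of a given $U\in\mathcal{O}(\mathbf{X})$ is semidecidable, i.e. $\{U\in\mathcal O(\mathbf X)\mid U\neq\emptyset\}$ is computably open in $\mathcal{O}(\mathbf{X})$. For a transitive relation $\ll$ on $\mathbb{N}$, an ideal is a non-empty $I\subseteq\mathbb{N}$ such that $x\ll y\in I$ implies $x\in I$, and for all $x,y\in I$ there is $z\in I$ with $x\ll z$ and $y\ll z$. $\mathbf{I}(\ll)$ is the represented space of ideals, where $p$ names $I$ iff $I=\{p(k)\mid k\in\mathbb{N}\}$. A represented space is precomputably Quasi-Polish if it is computably isomorphic to $\mathbf{I}(\ll)$ for some computably enumerable transitive relation $\ll$ on $\mathbb N$; it is computably Quasi-Polish if it is moreover computably overt. For an equivalence relation $R$ on $\mathbb{N}$, the quotient $\mathbb{N}/R$ is the represented space of $R$-classes where a name of a class is a name of any of its elements.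
   Formalization: The formal theorem assumes X is non-empty; for empty X the equivalence fails: with the empty relation as ≪, I(≪) is empty, so X satisfies (1), while N/R is never empty, so (2) and (3) fail. *)

(* Defs.v *)
From Stdlib Require Import Arith Cantor Lia RelationClasses.
From Stdlib Require Import ClassicalEpsilon FunctionalExtensionality
  PropExtensionality ProofIrrelevance.

(** * Partial functions and Baire space *)

Record pfun (A B : Type) := Pfun {
  graph :> A -> B -> Prop;
  graph_functional : forall a b b', graph a b -> graph a b' -> b = b' }.
Arguments graph {A B} _ _ _.
Arguments graph_functional {A B} _ {a b b'} _ _.

Definition total {A B : Type} (f : A -> B) : pfun A B :=
  @Pfun A B (fun a b => f a = b) (fun a b b' H H' => eq_trans (eq_sym H) H').

Definition baire := nat -> nat.

Definition agree (k : nat) (p q : baire) := forall i, i < k -> p i = q i.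

Definition pcontinuous (F : pfun baire baire) :=
  forall p q, F p q -> forall n, exists k,
    forall p' q', F p' q' -> agree k p p' -> q' n = q n.

(** Odd and even parts and their inverse, as in names of pairs. *)

Definition evens (p : baire) : baire := fun n => p (2 * n).
Definition odds (p : baire) : baire := fun n => p (2 * n + 1).
Definition join (p q : baire) : baire :=
  fun n => if Nat.even n then p (Nat.div2 n) else q (Nat.div2 n).
Definition shift (p : baire) : baire := fun n => p (S n).

(** * Oracle computation

    Programs are those of Kleene's partial recursive functions relative to an
    oracle, acting on single numbers; several arguments are packed with
    Cantor's pairing. *)

Inductive code :=
| c_zero | c_succ | c_left | c_right
| c_query
| c_pair (f g : code)
| c_comp (f g : code)
| c_prec (f g : code)
| c_mu (f : code).

Section Prec.
Variables (F G : nat -> nat -> Prop) (a : nat).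
Fixpoint prec (n y : nat) : Prop :=
  match n with
  | 0 => F a y
  | S m => exists z, prec m z /\ G (to_nat (a, to_nat (m, z))) y
  end.
End Prec.

(** [ev o c x y]: program [c] with oracle [o] halts on input [x] with
    output [y]. *)
Fixpoint ev (o : baire) (c : code) : nat -> nat -> Prop :=
  match c with
  | c_zero => fun x y => y = 0
  | c_succ => fun x y => y = S x
  | c_left => fun x y => y = fst (of_nat x)
  | c_right => fun x y => y = snd (of_nat x)
  | c_query => fun x y => y = o x
  | c_pair f g => fun x y =>
      exists a b, ev o f x a /\ ev o g x b /\ y = to_nat (a, b)
  | c_comp f g => fun x y => exists z, ev o g x z /\ ev o f z y
  | c_prec f g => fun x y =>
      prec (ev o f) (ev o g) (fst (of_nat x)) (snd (of_nat x)) y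
  | c_mu f => fun x y =>
      ev o f (to_nat (x, y)) 0 /\
      forall m, m < y -> exists k, ev o f (to_nat (x, m)) (S k)
  end.

(** The index (Gödel number) of a program. *)
Fixpoint encode (c : code) : nat :=
  match c with
  | c_zero => to_nat (0, 0)
  | c_succ => to_nat (1, 0)
  | c_left => to_nat (2, 0)
  | c_right => to_nat (3, 0)
  | c_query => to_nat (4, 0)
  | c_pair f g => to_nat (5, to_nat (encode f, encode g))
  | c_comp f g => to_nat (6, to_nat (encode f, encode g))
  | c_prec f g => to_nat (7, to_nat (encode f, encode g))
  | c_mu f => to_nat (8, encode f)
  end.

Lemma to_nat_inj2 {a b a' b'} :
  to_nat (a, b) = to_nat (a', b') -> a = a' /\ b = b'.
Proof.
intros H. apply (f_equal of_nat) in H. rewrite !cancel_of_to in H.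
now inversion H.
Qed.

Lemma encode_inj c c' : encode c = encode c' -> c = c'.
Proof.
revert c'; induction c; intros []; cbn [encode]; intros H;
  apply to_nat_inj2 in H; destruct H as [H1 H2]; try discriminate H1;
  try reflexivity;
  try (apply to_nat_inj2 in H2; destruct H2 as [H2 H3]); f_equal; auto.
Qed.

Lemma ev_det o c x y y' : ev o c x y -> ev o c x y' -> y = y'.
Proof.
revert x y y'; induction c; cbn [ev]; intros x y y' H H'; try congruence.
- destruct H as (a & b & Ha & Hb & ->), H' as (a' & b' & Ha' & Hb' & ->).
  now rewrite (IHc1 _ _ _ Ha Ha'), (IHc2 _ _ _ Hb Hb').
- destruct H as (a & Ha & Hb), H' as (a' & Ha' & Hb').
  rewrite (IHc1 _ _ _ Ha Ha') in Hb || rewrite (IHc2 _ _ _ Ha Ha') in Hb.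
  eauto.
- revert y y' H H'. generalize (snd (of_nat x)) as n.
  induction n as [|n IH]; cbn [prec]; intros y y' H H'; [eauto|].
  destruct H as (z & Hz & H), H' as (z' & Hz' & H').
  rewrite (IH _ _ Hz Hz') in H. eauto.
- destruct H as [H0 H], H' as [H0' H'].
  destruct (lt_eq_lt_dec y y') as [[L|E]|L]; [|exact E|].
  + destruct (H' _ L) as [k Hk]. discriminate (IHc _ _ _ H0 Hk).
  + destruct (H _ L) as [k Hk]. discriminate (IHc _ _ _ H0' Hk).
Qed.

Lemma agree_le k k' p q : k <= k' -> agree k' p q -> agree k p q.
Proof. intros L H i Hi. apply H; lia. Qed.

Lemma bounded_use (P : nat -> nat -> Prop) (n : nat) :
  (forall m k k', k <= k' -> P m k -> P m k') ->
  (forall m, m < n -> exists k, P m k) ->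
  exists k, forall m, m < n -> P m k.
Proof.
intros mono; induction n as [|n IH]; intros H; [exists 0; intros; lia|].
destruct IH as [k Hk]; [intros; apply H; lia|].
destruct (H n) as [k' Hk']; [lia|].
exists (k + k'). intros m Hm. destruct (Nat.eq_dec m n) as [->|].
- apply mono with k'; [lia|auto].
- apply mono with k; [lia|]. apply Hk; lia.
Qed.

Lemma ev_use o c x y : ev o c x y ->
  exists k, forall o', agree k o o' -> ev o' c x y.
Proof.
revert x y; induction c; cbn [ev]; intros x y H.
1-4: now exists 0.
- exists (S x). intros o' A. rewrite H. apply A; lia.
- destruct H as (a & b & Ha & Hb & ->).
  apply IHc1 in Ha as [k Hk]. apply IHc2 in Hb as [k' Hk'].
  exists (k + k'). intros o' A. exists a, b.
  split; [apply Hk; eapply agree_le; [|exact A]; lia|].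
  split; [apply Hk'; eapply agree_le; [|exact A]; lia|reflexivity].
- destruct H as (a & Ha & Hb).
  apply IHc2 in Ha as [k Hk]. apply IHc1 in Hb as [k' Hk'].
  exists (k + k'). intros o' A. exists a.
  split; [apply Hk|apply Hk']; (eapply agree_le; [|exact A]); lia.
- revert y H. generalize (snd (of_nat x)) as n.
  induction n as [|n IH]; cbn [prec]; intros y H; [eauto|].
  destruct H as (z & Hz & H).
  apply IH in Hz as [k Hk]. apply IHc2 in H as [k' Hk'].
  exists (k + k'). intros o' A. exists z.
  split; [apply Hk|apply Hk']; (eapply agree_le; [|exact A]); lia.
- destruct H as [H0 H]. apply IHc in H0 as [k Hk].
  destruct (bounded_use (fun m k => exists v, forall o', agree k o o' ->
    ev o' c (to_nat (x, m)) (S v)) y) as [k' Hk'].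
  + intros m j j' L [v Hv]. exists v. intros o' A. apply Hv.
    eapply agree_le; [exact L|exact A].
  + intros m L. destruct (H _ L) as [v Hv].
    apply IHc in Hv as [j Hj]. exists j, v. exact Hj.
  + exists (k + k'). intros o' A.
    split; [apply Hk; eapply agree_le; [|exact A]; lia|].
    intros m L. destruct (Hk' _ L) as [v Hv]. exists v. apply Hv.
    eapply agree_le; [|exact A]; lia.
Qed.

(** The partial function on Baire space computed by [c] with additional
    oracle [o]; the input of the function is itself given as an oracle. *)
Definition Phi_with (c : code) (o : baire) : pfun baire baire.
Proof.
refine (@Pfun _ _ (fun p q => forall n, ev (join o p) c n (q n)) _).
abstract (intros p q q' H H'; extensionality n;
  exact (ev_det _ _ _ _ _ (H n) (H' n))).
Defined.

Definition Phi (c : code) : pfun baire baire.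
Proof.
refine (@Pfun _ _ (fun p q => forall n, ev p c n (q n)) _).
abstract (intros p q q' H H'; extensionality n;
  exact (ev_det _ _ _ _ _ (H n) (H' n))).
Defined.

(** The domain of a computable partial function may be smaller than that of
    the machine computing it. *)
Definition pcomputable (F : pfun baire baire) :=
  exists c, forall p q, F p q -> Phi c p q.

Definition zeros : baire := fun _ => 0.

Definition computable_seq (p : baire) :=
  exists c, forall n, ev zeros c n (p n).

Definition ce_rel (R : nat -> nat -> Prop) :=
  exists c, forall x y, R x y <-> exists z, ev zeros c (to_nat (x, y)) z.

(** * Represented spaces *)

Record repspace := RepSpace {
  carrier :> Type;
  delta : pfun baire carrier;
  delta_surj : forall x, exists p, delta p x }.

Definition realises (X Y : repspace) (F : pfun baire baire) (f : pfun X Y) :=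
  forall p x y, delta X p x -> f x y -> exists q, F p q /\ delta Y q y.

Definition computable (X Y : repspace) (f : pfun X Y) :=
  exists F : pfun baire baire, pcomputable F /\ realises X Y F f.

Definition continuously_realisable (X Y : repspace) (f : X -> Y) :=
  exists F : pfun baire baire, pcontinuous F /\ realises X Y F (total f).

Definition computable_point (X : repspace) (x : X) :=
  exists p, computable_seq p /\ delta X p x.

Definition computably_isomorphic (X Y : repspace) :=
  exists (f : X -> Y) (g : Y -> X),
    (forall x, g (f x) = x) /\ (forall y, f (g y) = y) /\
    computable X Y (total f) /\ computable Y X (total g).

(** ** Products *)

Lemma evens_join p q : evens (join p q) = p.
Proof.
extensionality n. unfold evens, join.
now rewrite Nat.even_mul, Nat.div2_double.
Qed.

Lemma odds_join p q : odds (join p q) = q.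
Proof.
extensionality n. unfold odds, join.
rewrite Nat.even_add, Nat.even_mul; cbn [Nat.even orb Bool.eqb].
replace (2 * n + 1) with (S (2 * n)) by lia.
now rewrite Nat.div2_succ_double.
Qed.

Definition prod_space (X Y : repspace) : repspace.
Proof.
unshelve refine (@RepSpace (X * Y) (@Pfun _ _ (fun p z =>
  delta X (evens p) (fst z) /\ delta Y (odds p) (snd z)) _) _).
- abstract (intros p [x y] [x' y'] [H1 H2] [H1' H2']; cbn in *; f_equal;
    eapply graph_functional; eassumption).
- abstract (intros [x y]; destruct (delta_surj X x) as [p Hp];
    destruct (delta_surj Y y) as [q Hq]; exists (join p q); cbn;
    now rewrite evens_join, odds_join).
Defined.

(** ** Function spaces *)

(** Every continuous partial function on Baire space is computable with some
    oracle.  The oracle [table F] contains at (n, k, code of p|k) the value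
    [S v] if F p n = v is already determined by p|k. *)

Fixpoint prefix (p : baire) (k : nat) : nat :=
  match k with 0 => 0 | S m => to_nat (prefix p m, p m) end.

Lemma prefix_agree p q k : prefix p k = prefix q k -> agree k p q.
Proof.
induction k as [|k IH]; cbn [prefix]; intros H i Hi; [lia|].
apply to_nat_inj2 in H as [H1 H2].
destruct (Nat.eq_dec i k) as [->|]; [exact H2|]. apply IH; [exact H1|lia].
Qed.

Definition determines (F : pfun baire baire) (n k s v : nat) :=
  (exists p q, F p q /\ prefix p k = s) /\
  forall p q, F p q -> prefix p k = s -> q n = v.

Definition table (F : pfun baire baire) : baire := fun i =>
  let n := fst (of_nat i) in
  let k := fst (of_nat (snd (of_nat i))) in
  let s := snd (of_nat (snd (of_nat i))) in
  match excluded_middle_informative (exists v, determines F n k s v) with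
  | left H => S (proj1_sig (constructive_indefinite_description _ H))
  | right _ => 0
  end.

Lemma table_sound (F : pfun baire baire) n k p q v : F p q ->
  table F (to_nat (n, to_nat (k, prefix p k))) = S v -> q n = v.
Proof.
unfold table; rewrite !cancel_of_to; cbn [fst snd]; rewrite !cancel_of_to;
  cbn [fst snd]; intros Hpq.
destruct excluded_middle_informative as [E|]; [|discriminate].
destruct constructive_indefinite_description as [w Hw]; cbn.
intros [= <-]. now apply (proj2 Hw p q).
Qed.

Lemma table_complete (F : pfun baire baire) n p q : pcontinuous F -> F p q ->
  exists k v, table F (to_nat (n, to_nat (k, prefix p k))) = S v.
Proof.
intros C H. destruct (C p q H n) as [k Hk]. exists k.
unfold table; rewrite !cancel_of_to; cbn [fst snd]; rewrite !cancel_of_to;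
  cbn [fst snd].
destruct excluded_middle_informative as [E|E]; [eauto|].
destruct E. exists (q n). split; [eauto|].
intros p' q' H' E. apply (Hk p' q' H'). apply prefix_agree. now symmetry.
Qed.

Definition computes (o : baire) (c : code) (f : nat -> nat) :=
  forall x, ev o c x (f x).

Lemma computes_comp o c d f g :
  computes o c f -> computes o d g -> computes o (c_comp c d) (fun x => f (g x)).
Proof. intros Hc Hd x. exists (g x). auto. Qed.

Lemma computes_pair o c d f g : computes o c f -> computes o d g ->
  computes o (c_pair c d) (fun x => to_nat (f x, g x)).
Proof. intros Hc Hd x. exists (f x), (g x). auto. Qed.

Definition c_id := c_pair c_left c_right.
Definition c_double :=
  c_comp (c_prec c_zero (c_comp c_succ (c_comp c_succ (c_comp c_right c_right))))
    (c_pair c_zero c_id).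
Definition c_query_left := c_comp c_query c_double.
Definition c_query_right := c_comp c_query (c_comp c_succ c_double).
Definition c_prefix :=
  c_comp (c_prec c_zero (c_pair (c_comp c_right c_right)
            (c_comp c_query_right (c_comp c_left c_right))))
    (c_pair c_zero c_id).
Definition c_lookup :=
  c_comp c_query_left
    (c_pair c_left (c_pair c_right (c_comp c_prefix c_right))).
Definition c_iszero :=
  c_comp (c_prec (c_comp c_succ c_zero) c_zero) (c_pair c_zero c_id).
Definition c_pred :=
  c_comp (c_prec c_zero (c_comp c_left c_right)) (c_pair c_zero c_id).
Definition c_search :=
  c_comp c_pred (c_comp c_lookup
    (c_pair c_id (c_mu (c_comp c_iszero c_lookup)))).

Lemma computes_ext o c f g :
  computes o c f -> (forall x, f x = g x) -> computes o c g.
Proof. intros H E x. rewrite <- E. apply H. Qed.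

Lemma computes_id o : computes o c_id (fun x => x).
Proof.
intros x. exists (fst (of_nat x)), (snd (of_nat x)).
now rewrite <- surjective_pairing, cancel_to_of.
Qed.

Lemma computes_rec1 o c d (a0 : nat) g h :
  computes o c (fun _ => a0) -> computes o d g -> h 0 = a0 ->
  (forall m, h (S m) = g (to_nat (0, to_nat (m, h m)))) ->
  computes o (c_comp (c_prec c d) (c_pair c_zero c_id)) h.
Proof.
intros Hc Hd H0 HS x. exists (to_nat (0, x)). split.
- exists 0, x. repeat split; try apply computes_id.
- cbn [ev]. rewrite cancel_of_to; cbn [fst snd].
  induction x as [|x IH]; cbn [prec].
  + rewrite H0. apply Hc.
  + exists (h x). split; [exact IH|]. rewrite HS. apply Hd.
Qed.

Lemma computes_zero o : computes o c_zero (fun _ => 0).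
Proof. now intros x. Qed.
Lemma computes_succ o : computes o c_succ S.
Proof. now intros x. Qed.
Lemma computes_left o : computes o c_left (fun x => fst (of_nat x)).
Proof. now intros x. Qed.
Lemma computes_right o : computes o c_right (fun x => snd (of_nat x)).
Proof. now intros x. Qed.
Lemma computes_query o : computes o c_query o.
Proof. now intros x. Qed.

Local Hint Resolve computes_zero computes_succ computes_left computes_right
  computes_query computes_comp computes_pair computes_id : comput.

Lemma computes_double o : computes o c_double (fun x => 2 * x).
Proof.
eapply computes_rec1; [auto with comput|eauto 6 with comput|lia|].
intros m. cbv beta. rewrite cancel_of_to; cbn [fst snd].
rewrite cancel_of_to; cbn [fst snd]; lia.
Qed.
Local Hint Resolve computes_double : comput.

Lemma computes_query_left o p : computes (join o p) c_query_left o.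
Proof.
eapply computes_ext; [unfold c_query_left; eauto with comput|].
intros x. change (evens (join o p) x = o x). now rewrite evens_join.
Qed.

Lemma computes_query_right o p : computes (join o p) c_query_right p.
Proof.
eapply computes_ext; [unfold c_query_right; eauto with comput|].
intros x. cbv beta. replace (S (2 * x)) with (2 * x + 1) by lia.
change (odds (join o p) x = p x). now rewrite odds_join.
Qed.
Local Hint Resolve computes_query_left computes_query_right : comput.

Lemma computes_prefix o p : computes (join o p) c_prefix (prefix p).
Proof.
eapply computes_rec1; [auto with comput|eauto 8 with comput|reflexivity|].
intros m. cbv beta. rewrite !cancel_of_to; cbn [fst snd].
now rewrite cancel_of_to.
Qed.
Local Hint Resolve computes_prefix : comput.

Lemma computes_lookup o p : computes (join o p) c_lookup (fun x =>
  o (to_nat (fst (of_nat x),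
       to_nat (snd (of_nat x), prefix p (snd (of_nat x)))))).
Proof.
unfold c_lookup. apply computes_comp; [auto with comput|].
apply computes_pair; [auto with comput|].
apply computes_pair; [auto with comput|].
apply computes_comp; auto with comput.
Qed.

Lemma computes_iszero o :
  computes o c_iszero (fun x => match x with 0 => 1 | S _ => 0 end).
Proof.
apply computes_rec1 with (a0 := 1) (g := fun _ => 0); auto with comput.
Qed.

Lemma computes_pred o : computes o c_pred pred.
Proof.
eapply computes_rec1; [auto with comput|eauto with comput|reflexivity|].
intros m. cbv beta. rewrite !cancel_of_to; cbn [fst snd].
now rewrite cancel_of_to.
Qed.

Lemma least (P : nat -> Prop) n :
  P n -> exists m, P m /\ forall i, i < m -> ~ P i.
Proof.
induction n as [n IH] using (well_founded_induction lt_wf); intros H.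
destruct (excluded_middle_informative (exists i, i < n /\ P i)) as [[i [L Hi]]|N].
- exact (IH i L Hi).
- exists n. split; [exact H|]. intros i L Hi. apply N; eauto.
Qed.

Lemma continuous_oracle_computable (F : pfun baire baire) : pcontinuous F ->
  forall p q, F p q -> Phi_with c_search (table F) p q.
Proof.
intros C p q H n. set (o := table F).
pose (P k := exists v, o (to_nat (n, to_nat (k, prefix p k))) = S v).
destruct (table_complete F n p q C H) as [k0 Hk0].
destruct (least P k0 Hk0) as (k & [v Hv] & Hmin).
pose proof (table_sound _ _ _ _ _ _ H Hv) as Hq.
assert (L : forall j, ev (join o p) c_lookup (to_nat (n, j))
                  (o (to_nat (n, to_nat (j, prefix p j))))).
{ intros j. pose proof (@computes_lookup o p (to_nat (n, j))) as E.
  cbv beta in E. now rewrite cancel_of_to in E. }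
exists (S v). split; [|rewrite Hq; apply computes_pred].
exists (to_nat (n, k)). split; [|rewrite <- Hv; apply L].
exists n, k. split; [apply computes_id|]. split; [|reflexivity].
split.
- exists (S v). split; [rewrite <- Hv; apply L|apply computes_iszero].
- intros m Hm. exists 0. exists 0. split; [|apply computes_iszero].
  pose proof (L m) as Lm.
  destruct (o (to_nat (n, to_nat (m, prefix p m)))) as [|w] eqn:E; [exact Lm|].
  destruct (Hmin m Hm). exists w. exact E.
Qed.

(** [p] names [f] iff [p 0] is the index of a machine which, using the oracle
    [shift p], computes a realiser of [f]. *)
Definition fun_name (X Y : repspace) (p : baire) (f : X -> Y) :=
  exists c, p 0 = encode c /\ realises X Y (Phi_with c (shift p)) (total f).

Definition funspace (X Y : repspace) : repspace.
Proof.
unshelve refine (@RepSpace {f : X -> Y | continuously_realisable X Y f}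
  (@Pfun _ _ (fun p f => fun_name X Y p (proj1_sig f)) _) _).
- abstract (intros p [f Hf] [f' Hf'] (c & Hc & H) (c' & Hc' & H'); cbn in *;
  apply subset_eq_compat; extensionality x;
  rewrite Hc in Hc'; apply encode_inj in Hc'; subst c';
  destruct (delta_surj X x) as [q Hq];
  destruct (H q x _ Hq eq_refl) as (r & Hr & Dr);
  destruct (H' q x _ Hq eq_refl) as (r' & Hr' & Dr');
  rewrite (graph_functional _ Hr' Hr) in Dr';
  exact (graph_functional _ Dr Dr')).
- abstract (intros [f (F & C & H)]; cbn;
  exists (fun n => match n with 0 => encode c_search | S m => table F m end);
  exists c_search; split; [reflexivity|];
  intros p x y Hp E; destruct (H p x y Hp E) as (q & Hq & Hy);
  exists q; split; [|exact Hy]; exact (continuous_oracle_computable F C p q Hq)).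
Defined.

Lemma Phi_with_encode_continuous (q : baire) (F : pfun baire baire) :
  (forall p r, F p r -> exists c, p 0 = encode c /\ Phi_with c (shift p) q r) ->
  pcontinuous F.
Proof.
intros HF p r H n. destruct (HF _ _ H) as (c & Hc & Hr).
destruct (ev_use _ _ _ _ (Hr n)) as [k Hk].
exists (S k). intros p' r' H' A.
destruct (HF _ _ H') as (c' & Hc' & Hr').
assert (c' = c) as ->.
{ apply encode_inj. rewrite <- Hc, <- Hc'. symmetry. apply A. lia. }
eapply ev_det; [apply Hr'|]. apply Hk.
intros i Hi. unfold join. destruct (Nat.even i); [|reflexivity].
unfold shift. apply A. pose proof (Nat.div2_decr i i). lia.
Qed.

Lemma evaluation_continuous (X Y : repspace) (x : X) :
  continuously_realisable (funspace X Y) Y (fun f => proj1_sig f x).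
Proof.
destruct (delta_surj X x) as [q Hq].
unshelve eexists (@Pfun _ _ (fun p r =>
  exists c, p 0 = encode c /\ Phi_with c (shift p) q r) _).
- intros p r r' (c & Hc & H) (c' & Hc' & H').
  rewrite Hc in Hc'; apply encode_inj in Hc'; subst c'.
  exact (graph_functional _ H H').
- split.
  + apply Phi_with_encode_continuous with q. intros p r H; exact H.
  + intros p f y (c & Hc & H) <-.
    destruct (H q x _ Hq eq_refl) as (r & Hr & Dr).
    exists r. split; [|exact Dr]. exists c. now split.
Qed.

Definition evaluation (X Y : repspace) (x : X) : funspace (funspace X Y) Y :=
  exist _ (fun f : funspace X Y => proj1_sig f x) (evaluation_continuous X Y x).

(** ** Sierpinski space and open sets *)

Inductive sierpinski := bot | top.

Definition Sierp : repspace.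
Proof.
unshelve refine (@RepSpace sierpinski
  (@Pfun _ _ (fun p s => s = top <-> exists n, p n <> 0) _) _).
- abstract (intros p [] [] H H'; try reflexivity; exfalso;
    [assert (E : bot = top) by tauto|assert (E : bot = top) by tauto];
    discriminate E).
- abstract (intros [];
    [exists zeros; split; [discriminate|intros [n Hn]; now destruct Hn]
    |exists (fun _ => 1); split; [now exists 0|reflexivity]]).
Defined.

(** Open sets are identified with their characteristic functions. *)
Definition Opens (X : repspace) : repspace := funspace X Sierp.

Definition mem {X : repspace} (x : X) (U : Opens X) : Prop :=
  proj1_sig U x = top.

Definition computably_open (X : repspace) (A : X -> Prop) :=
  exists U : Opens X, computable_point (Opens X) U /\
    forall x, A x <-> mem x U.

Definition computably_discrete (X : repspace) :=
  computably_open (prod_space X X) (fun z => fst z = snd z).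

Definition computably_overt (X : repspace) :=
  computably_open (Opens X) (fun U => exists x, mem x U).

(** The open set of all open sets [U] containing [x]: its characteristic
    function maps [U] to the value at [x] of that of [U]. *)
Definition nbhds (X : repspace) (x : X) : Opens (Opens X) :=
  evaluation X Sierp x.

Definition computably_admissible (X : repspace) :=
  exists g : pfun (Opens (Opens X)) X,
    (forall V x, g V x <-> V = nbhds X x) /\ computable (Opens (Opens X)) X g.

(** ** Spaces of ideals *)

Record is_ideal (L : nat -> nat -> Prop) (I : nat -> Prop) : Prop := {
  ideal_nonempty : exists x, I x;
  ideal_lower : forall x y, L x y -> I y -> I x;
  ideal_directed : forall x y, I x -> I y -> exists z, I z /\ L x z /\ L y z }.

Definition enumerates (p : baire) (I : nat -> Prop) :=
  forall n, I n <-> exists k, p k = n.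

Lemma enumerates_functional p I J : enumerates p I -> enumerates p J -> I = J.
Proof.
intros H H'. extensionality n. apply propositional_extensionality.
now rewrite (H n), (H' n).
Qed.

Lemma enumerates_surj (I : nat -> Prop) :
  (exists x, I x) -> exists p, enumerates p I.
Proof.
intros [x Hx].
exists (fun k => if excluded_middle_informative (I k) then k else x).
intros n; split.
- intros Hn. exists n. now destruct excluded_middle_informative.
- intros [k <-]. now destruct excluded_middle_informative.
Qed.

Definition ideals (L : nat -> nat -> Prop) : repspace.
Proof.
unshelve refine (@RepSpace {I : nat -> Prop | is_ideal L I}
  (@Pfun _ _ (fun p I => enumerates p (proj1_sig I)) _) _).
- abstract (intros p [I HI] [J HJ] H H'; cbn in *; apply subset_eq_compat;
    exact (enumerates_functional p I J H H')).
- abstract (intros [I HI]; exact (enumerates_surj I (ideal_nonempty L I HI))).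
Defined.

Definition precomputably_quasi_polish (X : repspace) :=
  exists L : nat -> nat -> Prop,
    Transitive L /\ ce_rel L /\ computably_isomorphic X (ideals L).

Definition computably_quasi_polish (X : repspace) :=
  precomputably_quasi_polish X /\ computably_overt X.

(** ** Quotients of the natural numbers *)

Definition is_class (R : nat -> nat -> Prop) (C : nat -> Prop) :=
  exists n, forall m, C m <-> R n m.

Lemma class_unique (R : nat -> nat -> Prop) (HR : Equivalence R) C D n :
  is_class R C -> is_class R D -> C n -> D n -> C = D.
Proof.
intros [c Hc] [d Hd] H H'. apply Hc in H. apply Hd in H'.
extensionality m. apply propositional_extensionality.
rewrite (Hc m), (Hd m). split; intros E.
- transitivity n; [exact H'|]. transitivity c; [now symmetry|exact E].
- transitivity n; [exact H|]. transitivity d; [now symmetry|exact E].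
Qed.

Lemma class_inhabited (R : nat -> nat -> Prop) (HR : Equivalence R) C :
  is_class R C -> exists p : baire, C (p 0).
Proof. intros [n Hn]. exists (fun _ => n). apply Hn. reflexivity. Qed.

Definition quotient (R : nat -> nat -> Prop) (HR : Equivalence R) : repspace.
Proof.
unshelve refine (@RepSpace {C : nat -> Prop | is_class R C}
  (@Pfun _ _ (fun p C => proj1_sig C (p 0)) _) _).
- abstract (intros p [C HC] [D HD] H H'; cbn in *; apply subset_eq_compat;
    exact (class_unique R HR C D (p 0) HC HD H H')).
- abstract (intros [C HC]; exact (class_inhabited R HR C HC)).
Defined.

(* Main.v *)
(** A ceer is itself a transitive relation whose ideals are its classes, and
    membership in a given open set can be searched for on all classes; this makes
    its quotient discrete, quasi-Polish and overt.  It is admissible because [x]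
    can be found from its neighbourhood filter by searching for [n] such that
    the open set of all points equal to the class of [n] belongs to it.

    Conversely, let [X] be a discrete and overt space of ideals.  Overtness makes
    the set of numbers that lie in some ideal c.e., and each such number can be
    extended to an ascending chain, which generates an ideal.  A discrete
    space of ideals has only such points: every ideal is isolated, hence is the
    only ideal containing some number.  Equality of these ideals is the required
    ceer.

    An admissible quotient of the natural numbers comes from a ceer because two
    numbers are equivalent iff the inverse of [nbhds] halts on the name of an
    open set that is a neighbourhood filter only in that case. *)

Require Import Defs.
From Stdlib Require Import RelationClasses.
From Stdlib Require Import Arith Cantor Lia.
From Stdlib Require Import ClassicalEpsilon FunctionalExtensionality
  ProofIrrelevance.

Set Implicit Arguments.
Unset Strict Implicit.

(** * Functions computable uniformly in an oracle *)

Definition pr (a b : nat) : nat := to_nat (a, b).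
Definition pfst (z : nat) : nat := fst (of_nat z).
Definition psnd (z : nat) : nat := snd (of_nat z).

Lemma pfst_pr a b : pfst (pr a b) = a.
Proof. unfold pfst, pr. now rewrite cancel_of_to. Qed.

Lemma psnd_pr a b : psnd (pr a b) = b.
Proof. unfold psnd, pr. now rewrite cancel_of_to. Qed.

(** A total minimisation, arbitrary when [t] vanishes everywhere. It stops at a nonzero value,
    whereas [c_mu] stops at a zero. *)
Definition mu (t : nat -> nat) : nat := epsilon (inhabits 0)
  (fun k => t k <> 0 /\ forall i, i < k -> t i = 0).

Lemma mu_spec t : (exists k, t k <> 0) ->
  t (mu t) <> 0 /\ forall i, i < mu t -> t i = 0.
Proof.
intros [k Hk]. unfold mu. apply epsilon_spec.
destruct (least (fun k => t k <> 0) k Hk) as (m & Hm & Hmin).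
exists m. split; [exact Hm|]. intros i Hi. specialize (Hmin i Hi). lia.
Qed.

(** A single program serves all oracles in [P], typically the names of points of some space; nothing
    is asked of [f] at other oracles. The number argument acts as an environment in which all free
    variables are packed. *)
Definition effective (P : baire -> Prop) (f : baire -> nat -> nat) :=
  exists c, forall o, P o -> computes o c (f o).

Lemma eff_ext P f g : effective P f ->
  (forall o, P o -> forall z, f o z = g o z) -> effective P g.
Proof.
intros [c Hc] E. exists c. intros o Ho z. rewrite <- E by exact Ho. now apply Hc.
Qed.

Lemma eff_weaken (P Q : baire -> Prop) f :
  effective P f -> (forall o, Q o -> P o) -> effective Q f.
Proof. intros [c Hc] H. exists c. auto. Qed.

Section Closure.
Variable P : baire -> Prop.

Lemma eff_comp f g : effective P f -> effective P g ->
  effective P (fun o z => f o (g o z)).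
Proof.
intros [c Hc] [d Hd]. exists (c_comp c d). intros o Ho.
apply computes_comp; auto.
Qed.

Lemma eff_id : effective P (fun _ z => z).
Proof. exists c_id. intros o _. apply computes_id. Qed.

Lemma eff_query f : effective P f -> effective P (fun o z => o (f o z)).
Proof.
intros Hf. apply (@eff_comp (fun o => o)); [|exact Hf].
exists c_query. intros o _ z. reflexivity.
Qed.

Lemma eff_S f : effective P f -> effective P (fun o z => S (f o z)).
Proof.
apply (@eff_comp (fun _ z => S z)). exists c_succ. intros o _ z. reflexivity.
Qed.

Lemma eff_const n : effective P (fun _ _ => n).
Proof.
induction n as [|n IH]; [|now apply eff_S].
exists c_zero. intros o _ z. reflexivity.
Qed.

Lemma eff_pr f g : effective P f -> effective P g ->
  effective P (fun o z => pr (f o z) (g o z)).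
Proof.
intros [c Hc] [d Hd]. exists (c_pair c d). intros o Ho.
apply computes_pair; auto.
Qed.

Lemma eff_pfst f : effective P f -> effective P (fun o z => pfst (f o z)).
Proof.
apply (@eff_comp (fun _ z => pfst z)). exists c_left. intros o _ z. reflexivity.
Qed.

Lemma eff_psnd f : effective P f -> effective P (fun o z => psnd (f o z)).
Proof.
apply (@eff_comp (fun _ z => psnd z)). exists c_right. intros o _ z. reflexivity.
Qed.

(** The variables bound in the step are packed behind the environment, so [w] stands for
    [pr z (pr m r)] with [r] the previous value. This is the argument format of [c_prec]. *)
Lemma eff_rec f g n :
  effective P f ->
  effective P (fun o w => g o (pfst w) (pfst (psnd w)) (psnd (psnd w))) ->
  effective P n ->
  effective P (fun o z => nat_rect (fun _ => nat) (f o z) (g o z) (n o z)).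
Proof.
intros [cf Hf] [cg Hg] Hn.
assert (H : effective P (fun o w =>
  nat_rect (fun _ => nat) (f o (pfst w)) (g o (pfst w)) (psnd w))).
{ exists (c_prec cf cg). intros o Ho w. cbn [ev].
  change (fst (of_nat w)) with (pfst w). change (snd (of_nat w)) with (psnd w).
  induction (psnd w) as [|m IH]; cbn [prec nat_rect]; [now apply Hf|].
  eexists. split; [exact IH|].
  match goal with |- ev _ _ (to_nat (?a, to_nat (?b, ?d))) _ =>
    change (to_nat (a, to_nat (b, d))) with (pr a (pr b d));
    pose proof (Hg o Ho (pr a (pr b d))) as E end.
  cbv beta in E. now rewrite !pfst_pr, !psnd_pr, pfst_pr in E. }
pose proof (eff_comp H (eff_pr eff_id Hn)) as H'.
apply (eff_ext H'). intros o _ z. cbv beta. now rewrite pfst_pr, psnd_pr.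
Qed.

Lemma eff_case n f g : effective P n -> effective P f ->
  effective P (fun o w => g o (pfst w) (psnd w)) ->
  effective P (fun o z =>
    match n o z with 0 => f o z | S m => g o z m end).
Proof.
intros Hn Hf Hg.
assert (H : effective P (fun o z =>
  nat_rect (fun _ => nat) (f o z) (fun m _ => g o z m) (n o z))).
{ apply (@eff_rec f (fun o z m _ => g o z m)); auto.
  pose proof (eff_comp Hg (eff_pr (eff_pfst eff_id) (eff_pfst (eff_psnd eff_id)))) as H.
  apply (eff_ext H). intros o _ z. cbv beta. now rewrite pfst_pr, psnd_pr. }
apply (eff_ext H). intros o _ z. now destruct (n o z).
Qed.

Lemma eff_pred f : effective P f -> effective P (fun o z => pred (f o z)).
Proof.
intros Hf. apply (@eff_case f f (fun _ _ m => m));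
  [exact Hf|exact Hf|apply eff_psnd, eff_id].
Qed.

Lemma eff_sub f g : effective P f -> effective P g ->
  effective P (fun o z => f o z - g o z).
Proof.
intros Hf Hg.
assert (H : effective P (fun o z =>
  nat_rect (fun _ => nat) (f o z) (fun _ r => pred r) (g o z))).
{ apply (@eff_rec f (fun _ _ _ r => pred r)); auto.
  apply eff_pred, eff_psnd, eff_psnd, eff_id. }
apply (eff_ext H). intros o _ z.
induction (g o z) as [|m IH]; cbn [nat_rect]; [lia|rewrite IH; lia].
Qed.

Lemma eff_if_eqb a b f g :
  effective P a -> effective P b -> effective P f -> effective P g ->
  effective P (fun o z => if a o z =? b o z then f o z else g o z).
Proof.
intros Ha Hb Hf Hg.
assert (H : effective P (fun o z => match a o z - b o z with
  | 0 => match b o z - a o z with 0 => f o z | S _ => g o z end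
  | S _ => g o z end)).
{ assert (Hg' : effective P (fun o w => g o (pfst w)))
    by (apply (eff_comp Hg), eff_pfst, eff_id).
  apply (@eff_case _ _ (fun o z _ => g o z)); auto using eff_sub.
  apply (@eff_case _ _ (fun o z _ => g o z)); auto using eff_sub. }
apply (eff_ext H). intros o _ z.
destruct (Nat.eqb_spec (a o z) (b o z)) as [->|N].
- now rewrite Nat.sub_diag.
- destruct (a o z - b o z) eqn:E1; [|reflexivity].
  destruct (b o z - a o z) eqn:E2; [lia|reflexivity].
Qed.

Lemma eff_if_even n f g :
  effective P n -> effective P f -> effective P g ->
  effective P (fun o z => if Nat.even (n o z) then f o z else g o z).
Proof.
intros Hn Hf Hg.
assert (H : effective P (fun o z => nat_rect (fun _ => nat) 1
  (fun _ r => if r =? 0 then 1 else 0) (n o z))).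
{ apply (@eff_rec (fun _ _ => 1) (fun _ _ _ r => if r =? 0 then 1 else 0));
    auto using eff_const, eff_if_eqb, eff_psnd, eff_id. }
pose proof (eff_if_eqb H (eff_const 0) Hg Hf) as H'.
apply (eff_ext H'). intros o _ z. cbv beta.
enough (E : nat_rect (fun _ => nat) 1 (fun _ r => if r =? 0 then 1 else 0) (n o z)
  = if Nat.even (n o z) then 1 else 0) by (rewrite E; now destruct (Nat.even _)).
induction (n o z) as [|m IH]; [reflexivity|].
cbn [nat_rect]. rewrite IH, Nat.even_succ, <- Nat.negb_even.
now destruct (Nat.even m).
Qed.

Lemma eff_div2 n : effective P n -> effective P (fun o z => Nat.div2 (n o z)).
Proof.
intros Hn.
assert (H : effective P (fun o z => nat_rect (fun _ => nat) 0
  (fun m r => if Nat.even m then r else S r) (n o z))).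
{ apply (@eff_rec (fun _ _ => 0) (fun _ _ m r => if Nat.even m then r else S r));
    auto 10 using eff_const, eff_if_even, eff_S, eff_pfst, eff_psnd, eff_id. }
apply (eff_ext H). intros o _ z.
induction (n o z) as [|m IH]; [reflexivity|].
cbn [nat_rect]. rewrite IH. clear IH. destruct (Nat.even m) eqn:E.
- apply Nat.even_spec in E as [k ->].
  now rewrite Nat.div2_double, Nat.div2_succ_double.
- assert (O : Nat.odd m = true) by now rewrite <- Nat.negb_even, E.
  apply Nat.odd_spec in O as [k ->].
  replace (2 * k + 1) with (S (2 * k)) by lia.
  rewrite Nat.div2_succ_double.
  replace (S (S (2 * k))) with (2 * S k) by lia.
  now rewrite Nat.div2_double.
Qed.

Lemma eff_join p q n :
  effective P (fun o w => p o (pfst w) (psnd w)) ->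
  effective P (fun o w => q o (pfst w) (psnd w)) ->
  effective P n ->
  effective P (fun o z => join (p o z) (q o z) (n o z)).
Proof.
intros Hp Hq Hn. unfold join.
apply (@eff_if_even n (fun o z => p o z (Nat.div2 (n o z)))
  (fun o z => q o z (Nat.div2 (n o z)))); [exact Hn| |].
- pose proof (eff_comp Hp (eff_pr eff_id (eff_div2 Hn))) as H.
  apply (eff_ext H). intros o _ z. cbv beta. now rewrite pfst_pr, psnd_pr.
- pose proof (eff_comp Hq (eff_pr eff_id (eff_div2 Hn))) as H.
  apply (eff_ext H). intros o _ z. cbv beta. now rewrite pfst_pr, psnd_pr.
Qed.

Lemma eff_mu t :
  effective P (fun o w => t o (pfst w) (psnd w)) ->
  (forall o, P o -> forall z, exists k, t o z k <> 0) ->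
  effective P (fun o z => mu (t o z)).
Proof.
intros Ht T.
(* The test is negated because [c_mu] looks for a zero. *)
assert (H : effective P (fun o w =>
  if t o (pfst w) (psnd w) =? 0 then 1 else 0))
  by auto using eff_if_eqb, eff_const.
destruct H as [c Hc]. exists (c_mu c). intros o Ho z.
assert (E : forall k, ev o c (to_nat (z, k)) (if t o z k =? 0 then 1 else 0)).
{ intros k. pose proof (Hc o Ho (pr z k)) as E. cbv beta in E.
  now rewrite pfst_pr, psnd_pr in E. }
destruct (mu_spec (T o Ho z)) as [H1 H2]. cbn [ev]. split.
- rewrite <- Nat.eqb_neq in H1. specialize (E (mu (t o z))). now rewrite H1 in E.
- intros m Hm. exists 0. specialize (E m). now rewrite (H2 m Hm) in E.
Qed.

End Closure.

Global Opaque pr pfst psnd.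

Definition cons (a : nat) (s : baire) : baire :=
  fun n => match n with 0 => a | S m => s m end.

Lemma eff_cons P a s n :
  effective P a ->
  effective P (fun o w => s o (pfst w) (psnd w)) ->
  effective P n ->
  effective P (fun o z => cons (a o z) (s o z) (n o z)).
Proof. intros Ha Hs Hn. unfold cons. now apply eff_case. Qed.

Ltac effective :=
  repeat match goal with
  | |- effective _ _ => assumption
  | |- effective _ (fun _ _ => ?n) => apply eff_const
  | |- effective _ (fun _ z => z) => apply eff_id
  | |- effective _ (fun o z => S (@?f o z)) => apply (@eff_S _ f)
  | |- effective _ (fun o z => pred (@?f o z)) => apply (@eff_pred _ f)
  | |- effective _ (fun o z => pfst (@?f o z)) => apply (@eff_pfst _ f)
  | |- effective _ (fun o z => psnd (@?f o z)) => apply (@eff_psnd _ f)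
  | |- effective _ (fun o z => pr (@?f o z) (@?g o z)) => apply (@eff_pr _ f g)
  | |- effective _ (fun o z => if @?a o z =? @?b o z then @?f o z else @?g o z) =>
      apply (@eff_if_eqb _ a b f g)
  | |- effective _ (fun o z => o (@?f o z)) => apply (@eff_query _ f)
  end; cbv beta.

(** * A universal oracle machine *)

(** A state is [pr 0 (program, input, stack)] while a subprogram is to be
    evaluated and [pr 1 (value, stack)] when one has returned.  A stack is a
    sequence of frames [(tag, data, rest)], one tag for each place where [ev]
    evaluates a proper subprogram; tag 0 marks the empty stack. *)
Definition eval_state (e x s : nat) : nat := pr 0 (pr e (pr x s)).
Definition return_state (v s : nat) : nat := pr 1 (pr v s).
Definition frame (t d s : nat) : nat := pr t (pr d s).

(** The frames pushed here and in [step_return] wait for: the first component of a pair (1), the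
    second (2), the inner value of a composition (3), the [m]-th value of a recursion of length [n]
    (4), the value at the current candidate of a search (5). *)
Definition step_eval (h : baire) (e x s : nat) : nat :=
  let a := pfst (psnd e) in
  let b := psnd (psnd e) in
  if pfst e =? 0 then return_state 0 s else
  if pfst e =? 1 then return_state (S x) s else
  if pfst e =? 2 then return_state (pfst x) s else
  if pfst e =? 3 then return_state (psnd x) s else
  if pfst e =? 4 then return_state (h x) s else
  if pfst e =? 5 then eval_state a x (frame 1 (pr b x) s) else
  if pfst e =? 6 then eval_state b x (frame 3 a s) else
  if pfst e =? 7 then
    eval_state a (pfst x) (frame 4 (pr b (pr (pfst x) (pr 0 (psnd x)))) s)
  else eval_state (psnd e) (pr x 0) (frame 5 (pr (psnd e) (pr x 0)) s).

Definition step_return (v t d s : nat) : nat :=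
  if t =? 1 then eval_state (pfst d) (psnd d) (frame 2 v s) else
  if t =? 2 then return_state (pr d v) s else
  if t =? 3 then eval_state d v s else
  if t =? 4 then
    let a := pfst (psnd d) in
    let m := pfst (psnd (psnd d)) in
    let n := psnd (psnd (psnd d)) in
    if m =? n then return_state v s
    else eval_state (pfst d) (pr a (pr m v))
           (frame 4 (pr (pfst d) (pr a (pr (S m) n))) s)
  else
    let x := pfst (psnd d) in
    let y := psnd (psnd d) in
    if v =? 0 then return_state y s
    else eval_state (pfst d) (pr x (S y)) (frame 5 (pr (pfst d) (pr x (S y))) s).

(** A halted state is a fixed point, so [run] keeps its value once it is nonzero. *)
Definition step (h : baire) (q : nat) : nat :=
  if pfst q =? 0 then
    step_eval h (pfst (psnd q)) (pfst (psnd (psnd q))) (psnd (psnd (psnd q)))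
  else
    let s := psnd (psnd q) in
    if pfst s =? 0 then q
    else step_return (pfst (psnd q)) (pfst s) (pfst (psnd s)) (psnd (psnd s)).

Definition result (q : nat) : nat :=
  if pfst q =? 0 then 0 else
  if pfst (psnd (psnd q)) =? 0 then S (pfst (psnd q)) else 0.

Definition empty_stack : nat := pr 0 0.

(** [S y] encodes halting within [k] steps with output [y]; [0] means that the
    machine is still running. *)
Definition run (h : baire) (e x k : nat) : nat :=
  result (nat_rect (fun _ => nat) (eval_state e x empty_stack)
    (fun _ => step h) k).

Lemma eff_step P h q :
  effective P (fun o w => h o (pfst w) (psnd w)) -> effective P q ->
  effective P (fun o z => step (h o z) (q o z)).
Proof.
intros Hh Hq. unfold step, step_eval, step_return, return_state, eval_state, frame.
cbv zeta. effective.
pose proof (eff_comp Hh (eff_pr (eff_id P) 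
  (eff_pfst (eff_psnd (eff_psnd Hq))))) as H.
apply (eff_ext H). intros o _ z. cbv beta. now rewrite pfst_pr, psnd_pr.
Qed.

(** The oracle of the simulated machine may itself be computed from the actual oracle and the
    environment; this is what the machine is built for. *)
Lemma eff_run P h e x k :
  effective P (fun o w => h o (pfst w) (psnd w)) ->
  effective P e -> effective P x -> effective P k ->
  effective P (fun o z => run (h o z) (e o z) (x o z) (k o z)).
Proof.
intros Hh He Hx Hk. unfold run.
assert (H : effective P (fun o z => nat_rect (fun _ => nat)
  (eval_state (e o z) (x o z) empty_stack) (fun _ => step (h o z)) (k o z))).
{ unfold eval_state. apply (@eff_rec _ _ (fun o z _ c => step (h o z) c));
    [effective| |assumption].
  apply (@eff_step _ (fun o z => h o (pfst z))); [|effective].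
  assert (Hw : effective P (fun o w => pr (pfst (pfst w)) (psnd w))) by effective.
  apply (eff_ext (eff_comp Hh Hw)). intros o _ z. cbv beta.
  now rewrite pfst_pr, psnd_pr. }
unfold result. effective.
Qed.

(** * Correctness of the universal machine *)

Section Machine.
Variable h : baire.

Fixpoint steps (k q : nat) : nat :=
  match k with 0 => q | S k => steps k (step h q) end.

Lemma steps_rect q k : nat_rect (fun _ => nat) q (fun _ => step h) k = steps k q.
Proof.
revert q. induction k as [|k IH]; intros q; [reflexivity|].
cbn [steps nat_rect]. rewrite <- IH. clear IH.
induction k as [|k IH]; cbn [nat_rect]; congruence.
Qed.

Lemma steps_add i j q : steps (i + j) q = steps j (steps i q).
Proof. revert q. induction i as [|i IH]; intros q; [reflexivity|]. apply IH. Qed.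

Ltac machine :=
  unfold step, step_eval, step_return, return_state, eval_state, frame;
  cbv zeta; repeat (rewrite ?pfst_pr, ?psnd_pr; cbn [Nat.eqb]).

Lemma step_prim c x y s :
  match c with c_zero | c_succ | c_left | c_right | c_query => True
  | _ => False end ->
  ev h c x y -> step h (eval_state (encode c) x s) = return_state y s.
Proof.
destruct c; intros C; try destruct C; cbn [ev encode]; intros ->;
  change (to_nat (?a, ?b)) with (pr a b); machine; reflexivity.
Qed.

Lemma step_pair f g x s : step h (eval_state (encode (c_pair f g)) x s) =
  eval_state (encode f) x (frame 1 (pr (encode g) x) s).
Proof. cbn [encode]. repeat change (to_nat (?a, ?b)) with (pr a b). now machine. Qed.

Lemma step_pair1 v e x s : step h (return_state v (frame 1 (pr e x) s)) =
  eval_state e x (frame 2 v s).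
Proof. now machine. Qed.

Lemma step_pair2 v w s : step h (return_state v (frame 2 w s)) =
  return_state (pr w v) s.
Proof. now machine. Qed.

Lemma step_comp f g x s : step h (eval_state (encode (c_comp f g)) x s) =
  eval_state (encode g) x (frame 3 (encode f) s).
Proof. cbn [encode]. repeat change (to_nat (?a, ?b)) with (pr a b). now machine. Qed.

Lemma step_comp1 v e s : step h (return_state v (frame 3 e s)) = eval_state e v s.
Proof. now machine. Qed.

Lemma step_prec_start f g x s : step h (eval_state (encode (c_prec f g)) x s) =
  eval_state (encode f) (pfst x)
    (frame 4 (pr (encode g) (pr (pfst x) (pr 0 (psnd x)))) s).
Proof. cbn [encode]. repeat change (to_nat (?a, ?b)) with (pr a b). now machine. Qed.

Lemma step_prec_done v e a n s :
  step h (return_state v (frame 4 (pr e (pr a (pr n n))) s)) = return_state v s.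
Proof. machine. now rewrite Nat.eqb_refl. Qed.

Lemma step_prec_next v e a m n s : m <> n ->
  step h (return_state v (frame 4 (pr e (pr a (pr m n))) s)) =
  eval_state e (pr a (pr m v)) (frame 4 (pr e (pr a (pr (S m) n))) s).
Proof. intros N. machine. apply Nat.eqb_neq in N. now rewrite N. Qed.

Lemma step_mu_start f x s : step h (eval_state (encode (c_mu f)) x s) =
  eval_state (encode f) (pr x 0) (frame 5 (pr (encode f) (pr x 0)) s).
Proof. cbn [encode]. repeat change (to_nat (?a, ?b)) with (pr a b). now machine. Qed.

Lemma step_mu_done e x y s :
  step h (return_state 0 (frame 5 (pr e (pr x y)) s)) = return_state y s.
Proof. now machine. Qed.

Lemma step_mu_next v e x y s :
  step h (return_state (S v) (frame 5 (pr e (pr x y)) s)) =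
  eval_state e (pr x (S y)) (frame 5 (pr e (pr x (S y))) s).
Proof. now machine. Qed.

Definition reaches (q q' : nat) := exists k, steps k q = q'.

Lemma reaches_refl q : reaches q q.
Proof. now exists 0. Qed.

Lemma reaches_trans q q' q'' : reaches q q' -> reaches q' q'' -> reaches q q''.
Proof. intros [i <-] [j <-]. exists (i + j). apply steps_add. Qed.

Lemma reaches_step q q' q'' : step h q = q' -> reaches q' q'' -> reaches q q''.
Proof. intros <- [k <-]. now exists (S k). Qed.

(** The stack is arbitrary because the induction meets each subprogram on top of the frames of its
    callers. *)
Lemma reaches_return c x y s : ev h c x y ->
  reaches (eval_state (encode c) x s) (return_state y s).
Proof.
revert x y s; induction c; intros x y s H.
1-5: eapply reaches_step; [refine (step_prim s _ H); exact I|apply reaches_refl].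
- destruct H as (a & b & Ha & Hb & ->).
  eapply reaches_step; [apply step_pair|].
  eapply reaches_trans; [apply IHc1, Ha|].
  eapply reaches_step; [apply step_pair1|].
  eapply reaches_trans; [apply IHc2, Hb|].
  eapply reaches_step; [apply step_pair2|apply reaches_refl].
- destruct H as (a & Ha & Hb).
  eapply reaches_step; [apply step_comp|].
  eapply reaches_trans; [apply IHc2, Ha|].
  eapply reaches_step; [apply step_comp1|]. apply IHc1, Hb.
- cbn [ev] in H.
  change (fst (of_nat x)) with (pfst x) in H.
  change (snd (of_nat x)) with (psnd x) in H.
  set (n := psnd x) in *. set (a := pfst x) in *.
  assert (G : forall m z, m <= n -> prec (ev h c1) (ev h c2) a m z ->
    reaches (eval_state (encode (c_prec c1 c2)) x s)
      (return_state z (frame 4 (pr (encode c2) (pr a (pr m n))) s))).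
  { induction m as [|m IH]; intros z L Hz.
    - eapply reaches_step; [apply step_prec_start|]. apply IHc1, Hz.
    - destruct Hz as (w & Hw & Hz).
      eapply reaches_trans; [apply (IH w); [lia|exact Hw]|].
      eapply reaches_step; [apply step_prec_next; lia|]. apply IHc2, Hz. }
  eapply reaches_trans; [apply (G n y); auto|].
  eapply reaches_step; [apply step_prec_done|apply reaches_refl].
- destruct H as [H0 H].
  assert (G : forall m, m <= y -> reaches (eval_state (encode (c_mu c)) x s)
    (eval_state (encode c) (pr x m) (frame 5 (pr (encode c) (pr x m)) s))).
  { induction m as [|m IH]; intros L.
    - eapply reaches_step; [apply step_mu_start|apply reaches_refl].
    - eapply reaches_trans; [apply IH; lia|].
      destruct (H m L) as [v Hv].
      eapply reaches_trans; [apply IHc, Hv|].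
      eapply reaches_step; [apply step_mu_next|apply reaches_refl]. }
  eapply reaches_trans; [apply (G y); auto|].
  eapply reaches_trans; [apply IHc, H0|].
  eapply reaches_step; [apply step_mu_done|apply reaches_refl].
Qed.

Definition halts (k q v : nat) := result (steps k q) = S v.

(** An evaluation state has result 0, so a halting run starting there makes at least one more
    step. *)
Lemma halts_eval k e x s v : halts k (eval_state e x s) v ->
  exists j, k = S j /\ halts j (step h (eval_state e x s)) v.
Proof.
destruct k as [|k]; intros H; [|now exists k].
unfold halts in H. cbn [steps] in H. unfold result, eval_state in H.
rewrite pfst_pr in H. discriminate H.
Qed.

Lemma halts_frame k u t d s v : halts k (return_state u (frame (S t) d s)) v ->
  exists j, k = S j /\ halts j (step h (return_state u (frame (S t) d s))) v.
Proof.
destruct k as [|k]; intros H; [|now exists k].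
unfold halts in H. cbn [steps] in H. unfold result, return_state, frame in H.
repeat (rewrite ?pfst_pr, ?psnd_pr in H; cbn [Nat.eqb] in H). discriminate H.
Qed.

Ltac advance H :=
  first [apply halts_eval in H|apply halts_frame in H];
  let E := fresh in destruct H as (? & E & H); try subst.

(** Converse of [reaches_return]: a run can halt only after every subprogram on its way has
    returned. The bound [j <= k] provides the decreasing measure for searches. *)
Lemma halts_return c x s k v : halts k (eval_state (encode c) x s) v ->
  exists y j, ev h c x y /\ j <= k /\ halts j (return_state y s) v.
Proof.
revert x s k v; induction c; intros x s k v H.
1-5: apply halts_eval in H as (j & -> & H);
  eexists; exists j; split; [cbn [ev]; reflexivity|]; split; [lia|];
  erewrite step_prim in H; [exact H|exact I|reflexivity].
- advance H. rewrite step_pair in H.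
  apply IHc1 in H as (a & j & Ha & L & H). advance H. rewrite step_pair1 in H.
  apply IHc2 in H as (b & j' & Hb & L' & H). advance H. rewrite step_pair2 in H.
  exists (pr a b). eexists. split; [exists a, b; now split|].
  split; [|exact H]. lia.
- advance H. rewrite step_comp in H.
  apply IHc2 in H as (a & j & Ha & L & H). advance H. rewrite step_comp1 in H.
  apply IHc1 in H as (b & j' & Hb & L' & H).
  exists b, j'. split; [now exists a|]. split; [lia|exact H].
- advance H. rewrite step_prec_start in H.
  apply IHc1 in H as (z & j & Hz & L & H).
  cbn [ev]. change (fst (of_nat x)) with (pfst x).
  change (snd (of_nat x)) with (psnd x).
  set (n := psnd x) in *. set (a := pfst x) in *.
  (* Here [d] counts the recursion steps still to be made. *)
  assert (G : forall d m z j, n = m + d -> prec (ev h c1) (ev h c2) a m z ->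
    halts j (return_state z (frame 4 (pr (encode c2) (pr a (pr m n))) s)) v ->
    exists y i, prec (ev h c1) (ev h c2) a n y /\ i <= j /\
      halts i (return_state y s) v).
  { clear - IHc2. intros d. induction d as [|d IHd]; intros m z j E Hz H.
    - assert (n = m) by lia. subst m. advance H. rewrite step_prec_done in H.
      exists z. eexists. split; [exact Hz|]. split; [|exact H]. lia.
    - advance H. rewrite step_prec_next in H by lia.
      apply IHc2 in H as (y & i & Hy & L & H).
      apply IHd in H as (y' & i' & Hy' & L' & H); [|lia|now exists z].
      exists y', i'. split; [exact Hy'|]. split; [lia|exact H]. }
  destruct (G n 0 z j) as (y & i & Hy & L' & H'); auto.
  exists y, i. split; [exact Hy|]. split; [lia|exact H'].
- advance H. rewrite step_mu_start in H.
  (* No bound on the search is known in advance, so the induction is on the number of machine steps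
     left. *)
  assert (G : forall k y,
    (forall m, m < y -> exists j, ev h c (to_nat (x, m)) (S j)) ->
    halts k (eval_state (encode c) (pr x y)
      (frame 5 (pr (encode c) (pr x y)) s)) v ->
    exists y' i, ev h (c_mu c) x y' /\ i <= k /\ halts i (return_state y' s) v).
  { clear - IHc. intros k. induction k as [k IHk] using (well_founded_induction lt_wf).
    intros y Hy H.
    apply IHc in H as (u & j & Hu & L & H). advance H. destruct u as [|u].
    - rewrite step_mu_done in H. exists y. eexists.
      split; [now split|]. split; [|exact H]. lia.
    - rewrite step_mu_next in H. apply IHk in H; [|lia|].
      + destruct H as (y' & i & Hy' & L' & H). exists y', i.
        split; [exact Hy'|]. split; [lia|exact H].
      + intros m Hm. destruct (Nat.eq_dec m y) as [->|N]; [now exists u|].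
        apply Hy. lia. }
  apply G in H as (y & i & Hy & L & H'); [|intros; lia].
  exists y, i. split; [exact Hy|]. split; [lia|exact H'].
Qed.

Lemma run_spec c x y : ev h c x y <-> exists k, run h (encode c) x k = S y.
Proof.
assert (D : forall u, step h (return_state u empty_stack) = return_state u empty_stack)
  by (intros u; unfold empty_stack; now machine).
assert (R : forall u, result (return_state u empty_stack) = S u).
{ intros u. unfold result, return_state, empty_stack.
  repeat (rewrite ?pfst_pr, ?psnd_pr; cbn [Nat.eqb]). reflexivity. }
unfold run. split.
- intros H. apply (reaches_return empty_stack) in H as [k H]. exists k.
  now rewrite steps_rect, H.
- intros [k H]. rewrite steps_rect in H.
  apply halts_return in H as (z & j & Hz & _ & H). unfold halts in H.
  enough (E : steps j (return_state z empty_stack) = return_state z empty_stack)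
    by (rewrite E, R in H; now injection H as <-).
  clear H. induction j as [|j IH]; cbn [steps]; [reflexivity|]. now rewrite D.
Qed.
End Machine.

(** The universal machine runs [c] on the computed oracle [h o z], and [mu] finds a sufficient
    number of steps; it exists since [c] halts whenever [o] is in [P]. *)
Lemma eff_ev P c h x y :
  effective P (fun o w => h o (pfst w) (psnd w)) -> effective P x ->
  (forall o, P o -> forall z, ev (h o z) c (x o z) (y o z)) ->
  effective P y.
Proof.
intros Hh Hx Hy.
assert (T : forall o, P o -> forall z, exists k,
  run (h o z) (encode c) (x o z) k <> 0).
{ intros o Ho z. destruct (proj1 (run_spec _ _ _ _) (Hy o Ho z)) as [k Hk].
  exists k. now rewrite Hk. }
assert (Hr : effective P (fun o z =>
  mu (fun k => run (h o z) (encode c) (x o z) k))).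
{ apply (@eff_mu P (fun o z => run (h o z) (encode c) (x o z))); [|exact T].
  apply (@eff_run P (fun o w => h o (pfst w)) _ (fun o w => x o (pfst w)));
    effective; [|now apply (eff_comp Hx), eff_pfst, eff_id].
  assert (Hw : effective P (fun o w => pr (pfst (pfst w)) (psnd w))) by effective.
  apply (eff_ext (eff_comp Hh Hw)). intros o _ w. cbv beta.
  now rewrite pfst_pr, psnd_pr. }
pose proof (eff_pred (eff_run Hh (eff_const P (encode c)) Hx Hr)) as H.
apply (eff_ext H). intros o Ho z. cbv beta.
destruct (mu_spec (T o Ho z)) as [N _].
destruct (run _ _ _ _) as [|v] eqn:E; [now destruct N|].
apply (ev_det (h o z) c (x o z)); [apply run_spec; eauto|now apply Hy].
Qed.

(** This is composition of functionals: an oracle computed from another oracle is fed to [v],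
    provided that it lands in the domain [P]. *)
Lemma eff_subst (P Q : baire -> Prop) v h x : effective P v ->
  (forall o, Q o -> forall z, P (h o z)) ->
  effective Q (fun o w => h o (pfst w) (psnd w)) -> effective Q x ->
  effective Q (fun o z => v (h o z) (x o z)).
Proof.
intros [c Hc] D Hh Hx. apply (@eff_ev Q c h x); auto.
intros o Ho z. apply Hc. now apply D.
Qed.

Lemma effective_use P v o z : effective P v -> P o ->
  exists k, forall o', P o' -> agree k o o' -> v o' z = v o z.
Proof.
intros [c Hc] Ho. destruct (ev_use _ _ _ _ (Hc o Ho z)) as [k Hk].
exists k. intros o' Ho' A. eapply ev_det; [now apply Hc|auto].
Qed.

Lemma eff_odds P n : effective P n -> effective P (fun o z => odds o (n o z)).
Proof.
intros Hn. apply (@eff_query _ (fun o z => 2 * n o z + 1)).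
assert (E : effective P (fun o z =>
  S (nat_rect (fun _ => nat) 0 (fun _ r => S (S r)) (n o z)))).
{ apply eff_S, (@eff_rec _ (fun _ _ => 0) (fun _ _ _ r => S (S r))); effective. }
apply (eff_ext E). intros o _ z.
induction (n o z) as [|m IH]; cbn [nat_rect] in *; lia.
Qed.

Lemma eff_evens P n : effective P n -> effective P (fun o z => evens o (n o z)).
Proof.
intros Hn. apply (@eff_query _ (fun o z => 2 * n o z)).
assert (E : effective P (fun o z =>
  nat_rect (fun _ => nat) 0 (fun _ r => S (S r)) (n o z))).
{ apply (@eff_rec _ (fun _ _ => 0) (fun _ _ _ r => S (S r))); effective. }
apply (eff_ext E). intros o _ z.
induction (n o z) as [|m IH]; cbn [nat_rect] in *; lia.
Qed.

(** * Realisers and names *)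

Definition dom (X : repspace) (p : baire) := exists x, delta X p x.

Lemma computable_elim (X Y : repspace) (f : pfun X Y) : computable X Y f -> exists c,
  forall p x y, delta X p x -> f x y -> exists q, Phi c p q /\ delta Y q y.
Proof.
intros (F & [c Hc] & HF). exists c. intros p x y Hx Hy.
destruct (HF p x y Hx Hy) as (q & Hq & D). exists q. auto.
Qed.

Lemma computable_total (X Y : repspace) (f : X -> Y) : computable X Y (total f) ->
  exists v : baire -> baire, effective (dom X) v /\
    forall p x, delta X p x -> delta Y (v p) (f x).
Proof.
intros H. destruct (computable_elim H) as [c Hc].
(* Making the realiser a total function of [p] allows it to occur in terms; its values outside
   [dom X] are arbitrary. *)
pose (v := fun p => epsilon (inhabits zeros) (fun q => Phi c p q)).
assert (Hv : forall p x, delta X p x -> Phi c p (v p) /\ delta Y (v p) (f x)).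
{ intros p x Hx. destruct (Hc p x _ Hx eq_refl) as (q & Hq & D).
  assert (E : Phi c p (v p)) by (apply epsilon_spec; now exists q).
  split; [exact E|]. now rewrite (graph_functional _ E Hq). }
exists v. split; [|intros p x Hx; now apply Hv].
exists c. intros p [x Hx]. exact (proj1 (Hv p x Hx)).
Qed.

Lemma computable_intro (X Y : repspace) (f : pfun X Y) P (v : baire -> baire) :
  effective P v ->
  (forall p x y, delta X p x -> f x y -> P p /\ delta Y (v p) y) ->
  computable X Y f.
Proof.
intros [c Hc] H. exists (Phi c). split; [now exists c|].
intros p x y Hx Hy. destruct (H p x y Hx Hy) as [Hp D].
exists (v p). split; [now apply Hc|exact D].
Qed.

Lemma Phi_with_continuous c o : pcontinuous (Phi_with c o).
Proof.
intros p q H n. destruct (ev_use _ _ _ _ (H n)) as [k Hk]. exists k.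
intros p' q' H' A. eapply ev_det; [apply H'|]. apply Hk.
intros i Hi. unfold join. destruct (Nat.even i); [reflexivity|].
(* Entry [i] of the join reads [p] at half of [i], so the bound on the use of the join also bounds
   the use of [p]. *)
apply A. pose proof (Nat.div2_decr i i). lia.
Qed.

Lemma Sierp_name p (s : sierpinski) : (s = top <-> exists n, p n <> 0) ->
  delta Sierp p s.
Proof. auto. Qed.

(** The index depends on [t] only: the parameter [s] of the open set goes into
    the oracle part of its name. *)
Lemma open_name (X : repspace) P t : effective P t -> exists e,
  forall s (A : X -> Prop),
  (forall q x, delta X q x ->
     P (join s q) /\ (A x <-> exists n, t (join s q) n <> 0)) ->
  exists U : Opens X, delta (Opens X) (cons e s) U /\ forall x, mem x U <-> A x.
Proof.
intros [c Hc]. exists (encode c). intros s A H.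
pose (f := fun x : X => if excluded_middle_informative (A x) then top else bot).
assert (Hf : forall x, f x = top <-> A x).
{ intros x. unfold f. now destruct excluded_middle_informative. }
assert (R : realises X Sierp (Phi_with c s) (total f)).
{ intros q x y Hx <-. destruct (H q x Hx) as [Hq E].
  exists (t (join s q)). split; [now apply Hc|]. apply Sierp_name.
  now rewrite Hf. }
exists (exist _ f (ex_intro _ _ (conj (@Phi_with_continuous c s) R))).
split; [|exact Hf]. exists c. split; [reflexivity|exact R].
Qed.

(** The universal machine, run on names [p] of an open set and [q] of a point;
    membership is the existence of a [k] with a nonzero value. *)
Definition acc (p q : baire) (k : nat) : nat :=
  pred (run (join (shift p) q) (p 0) (pfst k) (psnd k)).

(** The witness [k] packs a position in the computed Sierpinski name with a number of steps. By
    [pred], a machine still running counts as output 0, which accepts nothing. *)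
Lemma acc_spec (X : repspace) p q (U : Opens X) (x : X) :
  delta (Opens X) p U -> delta X q x ->
  (mem x U <-> exists k, acc p q k <> 0).
Proof.
intros (c & Hc & HU) Hx. destruct (HU q x _ Hx eq_refl) as (r & Hr & D).
unfold mem. transitivity (exists n, r n <> 0); [exact D|]. unfold acc. rewrite Hc.
split.
- intros [n Hn]. destruct (proj1 (run_spec _ _ _ _) (Hr n)) as [k Hk].
  exists (pr n k). now rewrite pfst_pr, psnd_pr, Hk.
- intros [k Hk]. exists (pfst k).
  destruct (run _ _ _ _) as [|v] eqn:E; [now destruct Hk|].
  rewrite (ev_det _ _ _ _ _ (Hr (pfst k)) (proj2 (run_spec _ _ _ _) (ex_intro _ _ E))).
  exact Hk.
Qed.

Lemma eff_arg2 P p a b :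
  effective P (fun o w => p o (pfst w) (psnd w)) -> effective P a -> effective P b ->
  effective P (fun o z => p o (a o z) (b o z)).
Proof.
intros Hp Ha Hb. apply (eff_ext (eff_comp Hp (eff_pr Ha Hb))).
intros o _ z. cbv beta. now rewrite pfst_pr, psnd_pr.
Qed.

Lemma eff_acc P p q k :
  effective P (fun o w => p o (pfst w) (psnd w)) ->
  effective P (fun o w => q o (pfst w) (psnd w)) ->
  effective P k ->
  effective P (fun o z => acc (p o z) (q o z) (k o z)).
Proof.
intros Hp Hq Hk. unfold acc. apply eff_pred.
apply (@eff_run P (fun o z => join (shift (p o z)) (q o z)));
  effective; [|now apply (eff_arg2 Hp); effective].
apply (@eff_join P (fun o w => shift (p o (pfst w))) (fun o w => q o (pfst w)));
  unfold shift; [apply (eff_arg2 Hp)|apply (eff_arg2 Hq)|]; effective.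
Qed.

Lemma eff_computable_seq P p : computable_seq p -> effective P (fun _ => p).
Proof.
intros [c Hc]. apply (@eff_ev P c (fun _ _ => zeros) (fun _ z => z)); [| |now intros].
- apply (eff_const P 0).
- apply eff_id.
Qed.

Lemma computably_open_elim (X : repspace) (A : X -> Prop) : computably_open X A ->
  exists t, effective (fun _ => True) t /\
    forall p x, delta X p x -> (A x <-> exists n, t p n <> 0).
Proof.
intros (U & (u & Hu & DU) & HA). exists (acc u). split.
- apply (@eff_acc _ (fun _ _ => u) (fun o _ => o)); [|effective|effective].
  apply (eff_comp (eff_computable_seq _ Hu)). effective.
- intros p x Hx. rewrite HA. now apply acc_spec.
Qed.

Lemma computably_open_intro (X : repspace) (A : X -> Prop) P t : effective P t ->
  (forall p x, delta X p x -> P p /\ (A x <-> exists n, t p n <> 0)) ->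
  computably_open X A.
Proof.
intros Ht H.
(* [open_name] supplies the name of the point as the odd half of the oracle; the even half is a
   parameter, here the dummy [zeros]. *)
assert (Ht' : effective (fun o => P (odds o)) (fun o => t (odds o))).
{ apply (eff_subst (h := fun o _ => odds o) (x := fun _ z => z) Ht); auto;
    [apply eff_odds|]; effective. }
destruct (open_name X Ht') as [e He].
destruct (He zeros A) as (U & DU & HU).
{ intros q x Hx. rewrite odds_join. now apply H. }
exists U. split; [|intros x; symmetry; apply HU].
exists (cons e zeros). split; [|exact DU].
assert (E : effective (fun _ => True) (fun _ => cons e zeros)).
{ apply (@eff_cons _ (fun _ _ => e) (fun _ _ => zeros)); [..|effective];
    [apply eff_const|apply (eff_const _ 0)]. }
destruct E as [c Hc]. exists c. now apply Hc.
Qed.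

(** The third argument of [t] is a number of steps of the enumerating program. Closure under
    effective arguments lets [t] be used inside larger computations over any [P]. *)
Lemma ce_rel_elim R : ce_rel R -> exists t : nat -> nat -> nat -> nat,
  (forall P a b k, effective P a -> effective P b -> effective P k ->
     effective P (fun o z => t (a o z) (b o z) (k o z))) /\
  forall x y, R x y <-> exists k, t x y k <> 0.
Proof.
intros [c Hc]. exists (fun x y k => run zeros (encode c) (pr x y) k). split.
- intros P a b k Ha Hb Hk.
  apply (@eff_run P (fun _ _ => zeros)); effective. apply (eff_const P 0).
- intros x y. rewrite Hc. change (to_nat (x, y)) with (pr x y). split.
  + intros [z Hz]. apply run_spec in Hz as [k Hk]. exists k. now rewrite Hk.
  + intros [k Hk]. destruct (run _ _ _ _) as [|z] eqn:E; [now destruct Hk|].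
    exists z. apply run_spec. now exists k.
Qed.

Lemma ce_rel_intro R (t : nat -> nat -> nat) :
  effective (fun _ => True) (fun _ w => t (pfst w) (psnd w)) ->
  (forall x y, R x y <-> exists k, t (pr x y) k <> 0) -> ce_rel R.
Proof.
intros Ht HR.
assert (H : effective (fun _ => True) (fun _ w =>
  if t (pfst w) (psnd w) =? 0 then 1 else 0)).
{ apply (@eff_if_eqb _ (fun _ w => t (pfst w) (psnd w))); effective. }
destruct H as [c Hc]. exists (c_mu c). intros x y. rewrite HR.
change (to_nat (x, y)) with (pr x y).
assert (E : forall k, ev zeros c (to_nat (pr x y, k))
  (if t (pr x y) k =? 0 then 1 else 0)).
{ intros k. pose proof (Hc zeros I (pr (pr x y) k)) as E. cbv beta in E.
  now rewrite pfst_pr, psnd_pr in E. }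
split.
- intros T. destruct (mu_spec T) as [H1 H2]. exists (mu (t (pr x y))). split.
  + apply Nat.eqb_neq in H1. specialize (E (mu (t (pr x y)))). now rewrite H1 in E.
  + intros m Hm. exists 0. specialize (E m). now rewrite (H2 m Hm) in E.
- intros (k & H & _). exists k. intros N. specialize (E k). rewrite N in E.
  discriminate (ev_det _ _ _ _ _ E H).
Qed.

Lemma Opens_ext (X : repspace) (U V : Opens X) :
  (forall x, mem x U <-> mem x V) -> U = V.
Proof.
destruct U as [f Hf], V as [g Hg]. unfold mem. cbn [proj1_sig]. intros H.
apply subset_eq_compat. extensionality x. specialize (H x).
destruct (f x), (g x); try reflexivity; exfalso;
  [assert (E : bot = top) by now apply H|assert (E : bot = top) by now apply H];
  discriminate E.
Qed.

(** * Quotients of the natural numbers *)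

Section Quotient.
Variables (R : nat -> nat -> Prop) (hR : Equivalence R).
Notation Q := (quotient R hR).

Lemma class_is_class n : is_class R (R n).
Proof. now exists n. Qed.

Definition class (n : nat) : Q := exist _ (R n) (class_is_class n).

Lemma delta_class (p : baire) n : delta Q p (class n) <-> R n (p 0).
Proof. reflexivity. Qed.

Lemma class_eq m n : class m = class n <-> R m n.
Proof.
split.
- intros E. apply (f_equal (fun C => proj1_sig C n)) in E. cbn in E.
  rewrite E. reflexivity.
- intros H. apply (graph_functional (delta Q) (a := fun _ => n)).
  + exact H.
  + cbn. reflexivity.
Qed.

Lemma delta_quotient (p : baire) (C : Q) : delta Q p C <-> C = class (p 0).
Proof.
split.
- intros H. apply (graph_functional (delta Q) H). cbn. reflexivity.
- intros ->. cbn. reflexivity.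
Qed.

Lemma quotient_ind (C : Q) : exists n, C = class n.
Proof.
destruct (delta_surj Q C) as [p Hp]. exists (p 0). now apply delta_quotient.
Qed.

(** * Quotients by ceers *)

Section Ceer.
Hypothesis ceR : ce_rel R.

(** Singletons are open uniformly: the index [e] is fixed, and [n] enters only as the parameter. In
    the joined oracle, [o 0] is [n] and [o 1] is the first entry of the name of the point. *)
Lemma class_open : exists e, forall n, exists U : Opens Q,
  delta (Opens Q) (cons e (fun _ => n)) U /\ forall x, mem x U <-> x = class n.
Proof.
destruct (ce_rel_elim ceR) as (t & Ht & HR).
assert (E : effective (fun _ => True) (fun o k => t (o 0) (o 1) k)).
{ apply (Ht _ (fun o _ => o 0) (fun o _ => o 1)); effective. }
destruct (open_name Q E) as [e He]. exists e. intros n. apply He.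
intros q x Hx. split; [exact I|]. apply delta_quotient in Hx.
rewrite Hx, class_eq. rewrite <- HR. split; intros H; now symmetry.
Qed.

Lemma ceer_admissible : computably_admissible Q.
Proof.
destruct class_open as [e He].
(* The open singleton of [x'] is a neighbourhood of [x'], hence of [x]. *)
assert (inj : forall x x', nbhds Q x = nbhds Q x' -> x = x').
{ intros x x' E. destruct (quotient_ind x') as [n ->].
  destruct (He n) as (U & _ & HU). apply HU.
  change (mem U (nbhds Q x)). rewrite E. now apply HU. }
unshelve eexists (@Pfun _ _ (fun V x => V = nbhds Q x) _).
{ intros V x x' -> E. now apply inj. }
split; [reflexivity|].
(* Here [k] packs a candidate [n] with a witness that the singleton of its class is accepted by
   [p]. *)
pose (t := fun (p : baire) k => acc p (cons e (fun _ => pfst k)) (psnd k)).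
assert (D : forall p x, delta (Opens (Opens Q)) p (nbhds Q x) ->
  (forall k, t p k <> 0 -> x = class (pfst k)) /\ exists k, t p k <> 0).
{ intros p x Hp. split.
  - intros k Hk. destruct (He (pfst k)) as (U & DU & HU). apply HU.
    apply (acc_spec Hp DU). now exists (psnd k).
  - destruct (quotient_ind x) as [n ->]. destruct (He n) as (U & DU & HU).
    destruct (proj1 (acc_spec Hp DU)) as [k Hk]; [now apply HU|].
    exists (pr n k). unfold t. now rewrite pfst_pr, psnd_pr. }
set (P := fun p => exists k, t p k <> 0).
assert (E : effective P (fun p _ => pfst (mu (t p)))).
{ apply eff_pfst, (@eff_mu _ (fun p _ => t p)); [|intros o Ho _; exact Ho].
  apply (@eff_acc _ (fun p _ => p) (fun _ w => cons e (fun _ => pfst (psnd w))));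
    effective.
  apply (@eff_cons _ (fun _ _ => e) (fun _ w _ => pfst (psnd (pfst w)))); effective. }
apply (computable_intro E). intros p V x Hp HV. cbn in HV. subst V.
destruct (D p x Hp) as [D1 D2]. split; [exact D2|].
apply delta_quotient. apply D1, (mu_spec D2).
Qed.

Lemma class_ideal C : is_class R C -> is_ideal R C.
Proof.
intros [n Hn]. split.
- exists n. apply Hn. reflexivity.
- intros x y H Hy. apply Hn. apply Hn in Hy. transitivity y; [exact Hy|now symmetry].
- intros x y Hx Hy. exists n. rewrite !Hn in *. split; [reflexivity|].
  split; now symmetry.
Qed.

(** Two elements of an ideal have a common upper bound, so they are equivalent when the relation is
    an equivalence. *)
Lemma ideal_class I : is_ideal R I -> is_class R I.
Proof.
intros [[n Hn] L D]. exists n. intros m. split.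
- intros Hm. destruct (D n m Hn Hm) as (z & _ & H1 & H2).
  transitivity z; [exact H1|now symmetry].
- intros H. apply L with n; [now symmetry|exact Hn].
Qed.

Lemma ceer_quasi_polish (X : repspace) :
  computably_isomorphic X Q -> precomputably_quasi_polish X.
Proof.
intros (f & g & gf & fg & Hf & Hg). exists R.
split; [exact _|]. split; [exact ceR|].
destruct (computable_total Hf) as (vf & Ef & Df).
destruct (computable_total Hg) as (vg & Eg & Dg).
destruct (ce_rel_elim ceR) as (t & Ht & HR).
exists (fun x => exist _ (proj1_sig (f x)) (class_ideal (proj2_sig (f x)))).
exists (fun I => g (exist _ (proj1_sig I) (ideal_class (proj2_sig I)))).
split; [|split; [|split]].
- intros x. cbn [proj1_sig]. transitivity (g (f x)); [|apply gf]. f_equal.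
  destruct (f x). now apply subset_eq_compat.
- intros [I HI]. apply subset_eq_compat. cbn [proj1_sig]. now rewrite fg.
(* The class of [vf p 0] is enumerated: [k] packs a candidate with a number of steps, and [vf p 0]
   itself is the default for unsuccessful [k]. *)
- assert (E : effective (dom X) (fun p k =>
    if t (vf p 0) (pfst k) (psnd k) =? 0 then vf p 0 else pfst k)).
  { assert (E0 : effective (dom X) (fun p _ => vf p 0)).
    { apply (eff_subst (h := fun p _ => p) (x := fun _ _ => 0) Ef); auto; effective. }
    apply (@eff_if_eqb _ (fun p k => t (vf p 0) (pfst k) (psnd k)) _ (fun p _ => vf p 0));
      effective.
    apply (Ht _ (fun p _ => vf p 0)); effective. }
  apply (computable_intro E). intros p x y Hx <-. split; [now exists x|].
  pose proof (Df p x Hx) as D. apply delta_quotient in D. cbn [ideals delta graph].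
  intros n. cbn [proj1_sig]. rewrite D. cbn [class proj1_sig]. split.
  + intros H. apply HR in H as [k Hk]. exists (pr n k). rewrite pfst_pr, psnd_pr.
    apply Nat.eqb_neq in Hk. now rewrite Hk.
  + intros [k <-]. destruct (Nat.eqb_spec (t (vf p 0) (pfst k) (psnd k)) 0) as [_|N].
    * reflexivity.
    * apply HR. eauto.
(* A sequence enumerating a class begins with an element of it, so it already names that class. *)
- assert (E : effective (dom Q) vg) by exact Eg.
  apply (computable_intro E). intros p I x Hp <-.
  assert (D : delta Q p (exist _ (proj1_sig I) (ideal_class (proj2_sig I)))).
  { cbn. apply Hp. now exists 0. }
  split; [eexists; exact D|]. now apply Dg.
Qed.

(** Points are equal iff their images in the quotient are, and [R] semidecides this on the first
    entries of the names of the images. *)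
Lemma ceer_discrete (X : repspace) :
  computably_isomorphic X Q -> computably_discrete X.
Proof.
intros (f & g & gf & fg & Hf & Hg).
destruct (computable_total Hf) as (vf & Ef & Df).
destruct (ce_rel_elim ceR) as (t & Ht & HR).
set (P := fun p => dom X (evens p) /\ dom X (odds p)).
assert (E : effective P (fun p k => t (vf (evens p) 0) (vf (odds p) 0) k)).
{ apply (Ht _ (fun p _ => vf (evens p) 0) (fun p _ => vf (odds p) 0)); [| |effective].
  - apply (eff_subst (h := fun p _ => evens p) (x := fun _ _ => 0) Ef); [| |effective].
    + intros p Hp _. apply Hp.
    + apply eff_evens. effective.
  - apply (eff_subst (h := fun p _ => odds p) (x := fun _ _ => 0) Ef); [| |effective].
    + intros p Hp _. apply Hp.
    + apply eff_odds. effective. }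
apply (computably_open_intro E).
intros p [x y] [Hx Hy]. cbn [fst snd] in *. split; [split; eexists; eassumption|].
apply Df, delta_quotient in Hx. apply Df, delta_quotient in Hy.
rewrite <- HR, <- class_eq, <- Hx, <- Hy. split; [congruence|].
intros H. now rewrite <- (gf x), <- (gf y), H.
Qed.

Lemma ceer_overt (X : repspace) :
  computably_isomorphic X Q -> computably_overt X.
Proof.
intros (f & g & gf & fg & Hf & Hg).
destruct (computable_total Hg) as (vg & Eg & Dg).
assert (Dn : forall n, delta X (vg (fun _ => n)) (g (class n))).
{ intros n. apply Dg. apply delta_quotient. reflexivity. }
(* All classes are searched at once: [pfst k] represents a class and [psnd k] is the witness of
   acceptance. *)
assert (E : effective (fun _ => True) (fun p k => acc p (vg (fun _ => pfst k)) (psnd k))).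
{ apply (@eff_acc _ (fun p _ => p) (fun _ k => vg (fun _ => pfst k))); effective.
  apply (eff_subst (h := fun _ w _ => pfst (pfst w)) (x := fun _ w => psnd w) Eg);
    effective.
  intros _ _ z. exists (class (pfst (pfst z))). now apply delta_quotient. }
apply (computably_open_intro E). intros p U HU. split; [exact I|]. split.
- intros [x Hx]. rewrite <- (gf x) in Hx. destruct (quotient_ind (f x)) as [n Hn].
  rewrite Hn in Hx. apply (acc_spec HU (Dn n)) in Hx as [k Hk].
  exists (pr n k). now rewrite pfst_pr, psnd_pr.
- intros [k Hk]. exists (g (class (pfst k))). apply (acc_spec HU (Dn _)). eauto.
Qed.
End Ceer.

(** Let [A a b fl] consist of the [U] containing both [a] and [b], or containing
    [a] if the sequence [fl] takes the value 1, or containing [b] if it takes the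
    value 2.  If [R a b], then [A a b zeros] is the neighbourhood filter of [a],
    so the inverse of [nbhds] halts on its name.  Conversely, suppose that it
    halts there with output [m].  It has read a finite part of the name, which
    extends, by a late flag 1 or 2, to a name of the neighbourhood filter of [a]
    and to one of that of [b]; hence [R a m] and [R b m]. *)
Lemma admissible_ceer : computably_admissible Q -> ce_rel R.
Proof.
intros (g & Hg & Cg). destruct (computable_elim Cg) as [c Hc].
(* The even half of the oracle will be [a], [b], [fl 0], [fl 1], and so on, so [o 0] is [a], [o 2]
   is [b], and the tested entry is the flag at [pfst k]. The odd half is a name of [U]. *)
pose (t := fun (o : baire) k =>
  let hit (n : nat) j := acc (odds o) (fun _ => n) j in
  let a := o 0 in let b := o 2 in
  if evens o (S (S (pfst k))) =? 1 then hit a (psnd k)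
  else if evens o (S (S (pfst k))) =? 2 then hit b (psnd k)
  else if hit a (pfst (psnd k)) =? 0 then 0 else hit b (psnd (psnd k))).
assert (Et : effective (fun _ => True) t).
{ assert (Eh : forall n j, effective (fun _ => True) n -> effective (fun _ => True) j ->
    effective (fun _ => True) (fun o k => acc (odds o) (fun _ => n o k) (j o k))).
  { intros n j Hn Hj.
    apply (@eff_acc _ (fun o _ => odds o) (fun o k _ => n o k)); [| |exact Hj].
    - apply eff_odds. effective.
    - apply (eff_comp Hn). effective. }
  assert (Es : effective (fun _ => True) (fun o k => evens o (S (S (pfst k)))))
    by (apply eff_evens; effective).
  unfold t. cbv zeta.
  effective; [apply (Eh (fun o _ => o 0))|apply (Eh (fun o _ => o 2))
    |apply (Eh (fun o _ => o 0))|apply (Eh (fun o _ => o 2))]; effective. }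
destruct (open_name (Opens Q) Et) as [e He].
pose (s := fun a b (fl : baire) => cons e (cons a (cons b fl))).
pose (A := fun a b (fl : baire) (U : Opens Q) =>
  ((exists i, fl i = 1) /\ mem (class a) U) \/
  ((exists i, fl i = 2) /\ mem (class b) U) \/
  ((exists i, fl i <> 1 /\ fl i <> 2) /\ mem (class a) U /\ mem (class b) U)).
assert (HA : forall a b fl, exists V : Opens (Opens Q),
  delta (Opens (Opens Q)) (s a b fl) V /\ forall U, mem U V <-> A a b fl U).
{ intros a b fl. apply (He (cons a (cons b fl))). intros q U HU. split; [exact I|].
  assert (Hit : forall n, mem (class n) U <-> exists k, acc q (fun _ => n) k <> 0)
    by (intros n; apply acc_spec; [exact HU|now apply delta_quotient]).
  unfold A, t. rewrite evens_join, odds_join. rewrite !Hit.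
  change (join (cons a (cons b fl)) q 0) with a.
  change (join (cons a (cons b fl)) q 2) with b. cbn [cons]. split.
  - intros [[[i Hi] [k Hk]]|[[[i Hi] [k Hk]]|[[i [Hi Hi']] [[j Hj] [k Hk]]]]].
    + exists (pr i k). now rewrite pfst_pr, psnd_pr, Hi.
    + exists (pr i k). now rewrite pfst_pr, psnd_pr, Hi.
    + exists (pr i (pr j k)). rewrite !pfst_pr, !psnd_pr, pfst_pr.
      apply Nat.eqb_neq in Hi, Hi', Hj. now rewrite Hi, Hi', Hj.
  - intros [k Hk].
    destruct (Nat.eqb_spec (fl (pfst k)) 1) as [E1|E1]; [left; eauto|right].
    destruct (Nat.eqb_spec (fl (pfst k)) 2) as [E2|E2]; [left; eauto|right].
    destruct (Nat.eqb_spec (acc q (fun _ => a) (pfst (psnd k))) 0) as [E3|E3];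
      [now destruct Hk|split; [|split]; eauto]. }
assert (D : forall a b fl n, (forall U, A a b fl U <-> mem (class n) U) ->
  exists m, ev (s a b fl) c 0 m /\ R n m).
{ intros a b fl n H. destruct (HA a b fl) as (V & DV & HV).
  assert (EV : V = nbhds Q (class n)).
  { apply Opens_ext. intros U. rewrite HV. apply H. }
  destruct (Hc _ _ (class n) DV) as (q & Hq & Dq); [now apply Hg|].
  exists (q 0). split; [apply Hq|]. now apply delta_class in Dq. }
apply (@ce_rel_intro R (fun z k => run (s (pfst z) (psnd z) zeros) (encode c) 0 k)).
{ apply (@eff_run _ (fun _ w => s (pfst (pfst w)) (psnd (pfst w)) zeros)); effective.
  unfold s.
  apply (@eff_cons _ (fun _ _ => e)
    (fun _ w => cons (pfst (pfst (pfst w))) (cons (psnd (pfst (pfst w))) zeros)));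
    effective.
  apply (@eff_cons _ (fun _ w => pfst (pfst (pfst (pfst w))))
    (fun _ w => cons (psnd (pfst (pfst (pfst w)))) zeros)); effective.
  apply (@eff_cons _ (fun _ w => psnd (pfst (pfst (pfst (pfst w))))) (fun _ _ => zeros));
    effective. apply (eff_const _ 0). }
intros a b. rewrite pfst_pr, psnd_pr.
transitivity (exists m, ev (s a b zeros) c 0 m).
2:{ split.
  - intros [m Hm]. apply run_spec in Hm as [k Hk]. exists k. now rewrite Hk.
  - intros [k Hk]. destruct (run _ _ _ _) as [|m] eqn:E; [now destruct Hk|].
    exists m. apply run_spec. now exists k. }
split.
(* No flag of [zeros] is 1 or 2, so only the third alternative of [A] remains, and its two
   conditions agree because the classes are equal. *)
- intros H. destruct (D a b zeros a) as (m & Hm & _); [|now exists m].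
  intros U. unfold A. rewrite <- (proj2 (class_eq a b) H). split.
  + intros [[[i Hi] _]|[[[i Hi] _]|[_ H']]]; [discriminate Hi..|apply H'].
  + intros H'. right. right. split; [now exists 0|now split].
- intros [m Hm]. destruct (ev_use _ _ _ _ Hm) as [K HK].
  assert (G : forall v n, (v = 1 /\ n = a) \/ (v = 2 /\ n = b) -> R n m).
  { intros v n Hv. pose (fl := fun i => if i <? K then 0 else v).
    destruct (D a b fl n) as (m' & Hm' & HR).
    - intros U. unfold A.
      assert (F : forall i, fl i = 0 \/ fl i = v)
        by (intros i; unfold fl; destruct (i <? K); auto).
      assert (F' : fl K = v) by (unfold fl; now rewrite Nat.ltb_irrefl).
      destruct Hv as [[-> ->]|[-> ->]].
      + split; [|intros H; left; eauto].
        intros [[_ H]|[[[i Hi] _]|[_ [H _]]]]; [exact H| |exact H].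
        exfalso. destruct (F i); lia.
      + split; [|intros H; right; left; eauto].
        intros [[[i Hi] _]|[[_ H]|[_ [_ H]]]]; [|exact H|exact H].
        exfalso. destruct (F i); lia.
    - rewrite (ev_det _ _ _ _ _ (HK (s a b fl) ltac:(
        intros [|[|[|i]]] Hi; try reflexivity; cbn; unfold fl, zeros;
        destruct (Nat.ltb_spec i K); lia)) Hm'). exact HR. }
  transitivity m; [apply (G 1); auto|symmetry; apply (G 2); auto].
Qed.
End Quotient.

(** * Discrete spaces of ideals *)

Lemma ideal_bound L I (p : baire) n :
  Transitive L -> is_ideal L I -> (forall i, I (p i)) ->
  exists a, I a /\ forall i, i < n -> L (p i) a.
Proof.
intros T HI Hp. induction n as [|n (a & Ia & Ha)].
- destruct (ideal_nonempty L I HI) as [a Ia]. exists a. split; [exact Ia|lia].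
- destruct (ideal_directed L I HI a (p n) Ia (Hp n)) as (b & Ib & Hab & Hnb).
  exists b. split; [exact Ib|]. intros i Hi.
  destruct (Nat.eq_dec i n) as [->|N]; [exact Hnb|].
  apply T with a; [apply Ha; lia|exact Hab].
Qed.

(** * Ideals generated by ascending chains *)

Section Chain.
Variable L : nat -> nat -> Prop.
Hypothesis trL : Transitive L.
Variables (e : nat -> nat) (nx : nat -> nat).
Hypothesis nxP : forall i, L (e i) (e (nx i)).

Definition chain (i j : nat) : nat := nat_rect (fun _ => nat) i (fun _ => nx) j.

Definition chain_ideal (i m : nat) : Prop := exists j, L m (e (chain i j)).

Lemma chain_mono i j k : j < k -> L (e (chain i j)) (e (chain i k)).
Proof.
induction k as [|k IH]; intros H; [lia|].
destruct (Nat.eq_dec j k) as [->|N]; [apply nxP|].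
apply trL with (e (chain i k)); [apply IH; lia|apply nxP].
Qed.

Lemma chain_is_ideal i : is_ideal L (chain_ideal i).
Proof.
split.
- exists (e i). exists 1. apply nxP.
- intros x y H [j Hj]. exists j. now apply trL with y.
(* Position [j + k + 1] lies strictly beyond both [j] and [k], and the following element of the
   chain puts it in the ideal. *)
- intros x y [j Hj] [k Hk]. exists (e (chain i (j + k + 1))). split; [|split].
  + exists (j + k + 2). apply chain_mono. lia.
  + apply trL with (e (chain i j)); [exact Hj|]. apply chain_mono; lia.
  + apply trL with (e (chain i k)); [exact Hk|]. apply chain_mono; lia.
Qed.

Lemma chain_start i : chain_ideal i (e i).
Proof. exists 1. apply nxP. Qed.

End Chain.

Lemma effective_chain P nx i j : effective P (fun _ => nx) -> effective P i ->
  effective P j -> effective P (fun o z => chain nx (i o z) (j o z)).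
Proof.
intros Hn Hi Hj. unfold chain.
apply (@eff_rec _ i (fun _ _ _ r => nx r) j); [exact Hi| |exact Hj].
apply (eff_comp Hn). effective.
Qed.

(** The ceer identifies two indices when the chains started there generate the ideal of the same
    point. A quotient of the natural numbers always has a point, whence the assumption that [X] is
    inhabited. *)
Lemma discrete_ceer (X : repspace) : inhabited X ->
  computably_discrete X -> computably_quasi_polish X ->
  exists (R : nat -> nat -> Prop) (hR : Equivalence R),
    ce_rel R /\ computably_isomorphic X (quotient R hR).
Proof.
intros hX HD [(L & trL & ceL & F & G & GF & FG & HF & HG) HO].
pose proof hX as [x0].
destruct (computable_total HF) as (vF & EF & DF).
destruct (computable_total HG) as (vG & EG & DG).
destruct (ce_rel_elim ceL) as (t & Ht & HL).
destruct (computably_open_elim HD) as (td & Etd & Htd).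
destruct (computably_open_elim HO) as (to & Eto & Hto).
assert (Heq : forall p q x y, delta X p x -> delta X q y ->
  (x = y <-> exists k, td (join p q) k <> 0)).
{ intros p q x y Hx Hy. apply (Htd (join p q) (x, y)). cbn.
  now rewrite evens_join, odds_join. }
assert (Eeq : forall P p q k, effective P (fun o w => p o (pfst w) (psnd w)) ->
  effective P (fun o w => q o (pfst w) (psnd w)) -> effective P k ->
  effective P (fun o z => td (join (p o z) (q o z)) (k o z))).
{ intros P p q k Hp Hq Hk.
  apply (eff_subst (h := fun o z => join (p o z) (q o z)) Etd); auto.
  apply (@eff_join P (fun o w => p o (pfst w)) (fun o w => q o (pfst w)));
    [apply (eff_arg2 Hp)|apply (eff_arg2 Hq)|]; effective. }
(* Overtness makes [D] c.e., and [e] enumerates it. *)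
set (D := fun n => exists x : X, proj1_sig (F x) n).
assert (HDt : exists dt : nat -> nat -> nat,
  effective (fun _ => True) (fun _ w => dt (pfst w) (psnd w)) /\
  forall n, D n <-> exists k, dt n k <> 0).
{ set (P := fun o => dom X (odds o)).
  assert (E : effective P (fun o k =>
    if vF (odds o) k =? evens o 0 then 1 else 0)).
  { apply (@eff_if_eqb _ (fun o k => vF (odds o) k) (fun o _ => evens o 0));
      effective.
    - apply (eff_subst (h := fun o _ => odds o) (x := fun _ k => k) EF);
        [auto|apply eff_odds; effective|effective].
    - apply eff_evens. effective. }
  destruct (open_name X E) as [e He].
  (* The overtness test is applied to the open set of those [x] whose ideal contains [n]. *)
  exists (fun n => to (cons e (fun _ => n))). split.
  - apply (eff_subst (h := fun _ w => cons e (fun _ => pfst w)) Eto); effective;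
      [trivial|].
    apply (@eff_cons _ (fun _ _ => e) (fun _ w _ => pfst (pfst w))); effective.
  - intros n. destruct (He (fun _ => n) (fun x => proj1_sig (F x) n))
      as (U & DU & HU).
    { intros q x Hx. unfold P. rewrite odds_join. split; [now exists x|].
      pose proof (DF q x Hx n) as Hq. rewrite Hq. rewrite evens_join.
      split; intros [k Hk]; exists k.
      - now rewrite Hk, Nat.eqb_refl.
      - destruct (Nat.eqb_spec (vF q k) n) as [->|]; [reflexivity|now destruct Hk]. }
    rewrite <- (Hto _ _ DU). unfold D.
    split; intros [x Hx]; exists x; now apply HU. }
destruct HDt as (dt & Edt & Hdt).
destruct (ideal_nonempty L _ (proj2_sig (F x0))) as [d0 Hd0].
(* Each [k] packs a candidate with a witness for membership in [D]; the default [d0] keeps [e] total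
   with values in [D]. *)
set (e := fun k => if dt (pfst k) (psnd k) =? 0 then d0 else pfst k).
assert (De : forall k, D (e k)).
{ intros k. unfold e. destruct (Nat.eqb_spec (dt (pfst k) (psnd k)) 0) as [_|N].
  - now exists x0.
  - apply Hdt. eauto. }
assert (eD : forall n, D n -> exists k, e k = n).
{ intros n Hn. apply Hdt in Hn as [k Hk]. exists (pr n k). unfold e.
  rewrite pfst_pr, psnd_pr. apply Nat.eqb_neq in Hk. now rewrite Hk. }
assert (Ee : effective (fun _ => True) (fun _ => e)).
{ apply (@eff_if_eqb _ (fun _ k => dt (pfst k) (psnd k))); effective. }
set (nx := fun i => pfst (mu (fun k => t (e i) (e (pfst k)) (psnd k)))).
(* Some ideal contains [e i], and by directedness it has an element above [e i], which is again in
   [D]. *)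
assert (Tnx : forall i, exists k, t (e i) (e (pfst k)) (psnd k) <> 0).
{ intros i. destruct (De i) as [x Hx].
  destruct (ideal_directed _ _ (proj2_sig (F x)) _ _ Hx Hx) as (m & Hm & H & _).
  destruct (eD m) as [j <-]; [now exists x|].
  apply HL in H as [k Hk]. exists (pr j k). now rewrite pfst_pr, psnd_pr. }
assert (nxP : forall i, L (e i) (e (nx i))).
{ intros i. apply HL. destruct (mu_spec (Tnx i)) as [H _]. eauto. }
assert (Enx : effective (fun _ => True) (fun _ => nx)).
{ unfold nx. apply (@eff_pfst _ (fun _ i => mu _)).
  apply (@eff_mu _ (fun _ i k => t (e i) (e (pfst k)) (psnd k))); [|auto].
  apply (Ht _ (fun _ w => e (pfst w)) (fun _ w => e (pfst (psnd w)))); effective;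
    apply (eff_comp Ee); effective. }
pose (I := fun i => exist _ (chain_ideal L e nx i) (chain_is_ideal trL nxP i) : ideals L).
(* A computable name of [I i]: [k] packs a number, a position in the chain and a number of steps
   showing that the former lies below the latter's element. The default [e i] belongs to [I i]. *)
pose (w := fun i k =>
  if t (pfst k) (e (chain nx i (pfst (psnd k)))) (psnd (psnd k)) =? 0 then e i else pfst k).
assert (Dw : forall i, delta (ideals L) (w i) (I i)).
{ intros i m. cbn [I proj1_sig]. split.
  - intros [j Hj]. apply HL in Hj as [k Hk]. exists (pr m (pr j k)). unfold w.
    rewrite !pfst_pr, !psnd_pr, pfst_pr. apply Nat.eqb_neq in Hk. now rewrite Hk.
  - intros [k <-]. unfold w. destruct (Nat.eqb_spec
      (t (pfst k) (e (chain nx i (pfst (psnd k)))) (psnd (psnd k))) 0) as [_|N].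
    + now apply chain_start.
    + exists (pfst (psnd k)). apply HL. eauto. }
assert (Ew : effective (fun _ => True) (fun _ z => w (pfst z) (psnd z))).
{ assert (H : effective (fun _ => True) (fun _ z => e (pfst z)))
    by (apply (eff_comp Ee); effective).
  unfold w. effective.
  apply (Ht _ (fun _ z => pfst (psnd z))
    (fun _ z => e (chain nx (pfst z) (pfst (psnd (psnd z)))))); effective.
  apply (eff_comp Ee), effective_chain; effective. }
pose (a := fun i => G (I i)).
assert (Da : forall i, delta X (vG (w i)) (a i)) by (intros i; apply DG, Dw).
assert (Ea : forall P i, effective P i ->
  effective P (fun o z => vG (w (i o (pfst z))) (psnd z))).
{ intros P i Hi.
  apply (eff_subst (h := fun o z => w (i o (pfst z))) (x := fun _ z => psnd z) EG);
    effective.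
  - intros o _ z. eexists. apply Dw.
  - assert (Ew' : effective P (fun _ z => w (pfst z) (psnd z)))
      by (apply (eff_weaken Ew); auto).
    apply (eff_arg2 (p := fun _ => w) Ew'); effective.
    apply (eff_comp Hi); effective. }
(* If [x = x] is accepted after reading [K] entries of a name [p] of the ideal
   of [x], then any [e i] in that ideal above these entries has a chain ideal
   with a name that begins like [p], so that [x = a i]. *)
assert (surj : forall x, exists i, x = a i).
{ intros x. destruct (delta_surj (ideals L) (F x)) as [p Hp].
  pose proof (DG p (F x) Hp) as Hx. rewrite GF in Hx.
  destruct (proj1 (Heq _ _ _ _ Hx Hx) eq_refl) as [k Hk].
  set (P := fun o => dom (ideals L) (evens o) /\ dom (ideals L) (odds o)).
  assert (E : effective P (fun o k => td (join (vG (evens o)) (vG (odds o))) k)).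
  { apply (Eeq _ (fun o _ => vG (evens o)) (fun o _ => vG (odds o))); effective;
    [apply (eff_subst (h := fun o _ => evens o) (x := fun _ z => psnd z) EG)
    |apply (eff_subst (h := fun o _ => odds o) (x := fun _ z => psnd z) EG)];
    effective.
    - intros o Ho _. apply Ho.
    - apply eff_evens. effective.
    - intros o Ho _. apply Ho.
    - apply eff_odds. effective. }
  assert (Pp : forall q, dom (ideals L) q -> P (join p q)).
  { intros q Hq. unfold P. rewrite evens_join, odds_join.
    split; [now exists (F x)|exact Hq]. }
  destruct (effective_use (o := join p p) k E) as [K HK];
    [apply Pp; now exists (F x)|].
  destruct (@ideal_bound L _ p K trL (proj2_sig (F x))) as (b & Hb & HbK);
    [intros i; apply Hp; now exists i|].
  destruct (eD b) as [i <-]; [now exists x|]. exists i.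
  pose (q := fun n => if n <? K then p n else w i (n - K)).
  (* The entries copied from [p] lie below [e i], hence in [I i], and the remaining entries
     enumerate all of [I i]. *)
  assert (Hq : delta (ideals L) q (I i)).
  { intros m. split.
    - intros Hm. apply (Dw i) in Hm as [n <-]. exists (n + K). unfold q.
      destruct (Nat.ltb_spec (n + K) K) as [|_]; [lia|]. f_equal. lia.
    - intros [n <-]. unfold q. destruct (Nat.ltb_spec n K) as [Hn|_].
      + exists 0. now apply HbK.
      + apply (Dw i). eauto. }
  apply (Heq (vG p) (vG q)); [exact Hx|now apply DG|]. exists k.
  specialize (HK (join p q)). cbv beta in HK.
  rewrite !evens_join, !odds_join in HK. rewrite HK; [exact Hk| |].
  - apply Pp. now exists (I i).
  - intros j Hj. unfold join, q. destruct (Nat.even j); [reflexivity|].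
    pose proof (Nat.div2_decr j j). destruct (Nat.ltb_spec (Nat.div2 j) K); [reflexivity|lia]. }
pose (R := fun i j => a i = a j).
assert (hR : Equivalence R) by (split; unfold R; [easy|easy|congruence]).
exists R, hR. split.
- apply (@ce_rel_intro R
    (fun z k => td (join (vG (w (pfst z))) (vG (w (psnd z)))) k)).
  + apply (Eeq _ (fun _ z => vG (w (pfst (pfst z)))) (fun _ z => vG (w (psnd (pfst z)))));
      effective; [apply (Ea _ (fun _ z => pfst (pfst z)))|apply (Ea _ (fun _ z => psnd (pfst z)))];
      effective.
  + intros i j. rewrite pfst_pr, psnd_pr. now apply Heq.
- assert (cl : forall x, is_class R (fun j => x = a j)).
  { intros x. destruct (surj x) as [i ->]. now exists i. }
  assert (rep : forall C : quotient R hR, exists x, forall j, proj1_sig C j -> x = a j).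
  { intros C. destruct (quotient_ind C) as [n ->]. now exists (a n). }
  (* The point [x] goes to the class of all indices of chains that generate it; [g] picks the point
     that these indices share. *)
  pose (f := fun x => exist _ (fun j => x = a j) (cl x) : quotient R hR).
  pose (g := fun C : quotient R hR => epsilon hX (fun x => forall j, proj1_sig C j -> x = a j)).
  assert (gP : forall C j, proj1_sig C j -> g C = a j).
  { intros C. unfold g. apply epsilon_spec, rep. }
  exists f, g. split; [|split; [|split]].
  + intros x. destruct (surj x) as [i ->]. now apply gP.
  + intros C. destruct (quotient_ind C) as [n ->].
    apply (graph_functional (delta (quotient R hR)) (a := fun _ => n)).
    * cbn. now apply gP.
    * now apply delta_quotient.
  + assert (Et : effective (dom X) (fun o z =>
      td (join o (vG (w (pfst (psnd z))))) (psnd (psnd z)))).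
    { apply (Eeq _ (fun o _ => o) (fun _ z => vG (w (pfst (psnd z))))); effective.
      apply (Ea _ (fun _ z => pfst (psnd z))); effective. }
    (* To compute [f], the equality test compares the given name with the names of all [a i] in
       parallel; it must accept for some [i] by [surj], and any accepted [i] is correct. *)
    assert (T : forall o x, delta X o x ->
      (exists k, td (join o (vG (w (pfst k)))) (psnd k) <> 0) /\
      forall k, td (join o (vG (w (pfst k)))) (psnd k) <> 0 -> x = a (pfst k)).
    { intros o x Hx. split.
      - destruct (surj x) as [i Hi]. apply (Heq _ _ _ _ Hx (Da i)) in Hi as [k Hk].
        exists (pr i k). now rewrite pfst_pr, psnd_pr.
      - intros k Hk. apply (Heq _ _ _ _ Hx (Da _)). eauto. }
    assert (Em : effective (dom X) (fun o _ =>
      pfst (mu (fun k => td (join o (vG (w (pfst k)))) (psnd k))))).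
    { apply eff_pfst.
      apply (@eff_mu _ (fun o _ k => td (join o (vG (w (pfst k)))) (psnd k)));
        [exact Et|]. intros o [x Hx] _. now apply (T o x). }
    apply (computable_intro Em). intros p x C Hx <-. split; [now exists x|].
    cbn. destruct (T p x Hx) as [T1 T2]. apply T2, (mu_spec T1).
  + assert (Eg : effective (fun _ => True) (fun o => vG (w (o 0)))).
    { apply (eff_subst (h := fun o _ => w (o 0)) (x := fun _ z => z) EG);
        effective.
      - intros o _ _. eexists. apply Dw.
      - apply (eff_arg2 (p := fun _ => w) Ew (a := fun o _ => o 0)); effective. }
    apply (computable_intro Eg). intros p C x HC <-. split; [exact Logic.I|].
    rewrite (gP C (p 0)); [apply Da|exact HC].
Qed.

(** * Equivalence of the three characterisations *)

Unset Implicit Arguments.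

Theorem corollary15 (X : repspace) (hX : inhabited X) :
  ((computably_discrete X /\ computably_quasi_polish X) <->
   (exists (R : nat -> nat -> Prop) (hR : Equivalence R),
      computably_admissible (quotient R hR) /\
      computably_isomorphic X (quotient R hR)))
  /\
  ((exists (R : nat -> nat -> Prop) (hR : Equivalence R),
      computably_admissible (quotient R hR) /\
      computably_isomorphic X (quotient R hR)) <->
   (exists (R : nat -> nat -> Prop) (hR : Equivalence R),
      ce_rel R /\ computably_isomorphic X (quotient R hR))).
Proof.
assert (H23 : (exists (R : nat -> nat -> Prop) (hR : Equivalence R),
      computably_admissible (quotient R hR) /\
      computably_isomorphic X (quotient R hR)) <->
   (exists (R : nat -> nat -> Prop) (hR : Equivalence R),
      ce_rel R /\ computably_isomorphic X (quotient R hR))).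
{ split; intros (R & hR & H & HX); exists R, hR; (split; [|exact HX]).
  - exact (admissible_ceer H).
  - exact (ceer_admissible hR H). }
split; [|exact H23]. rewrite H23. split.
- intros [HD HQ]. exact (discrete_ceer hX HD HQ).
- intros (R & hR & H & HX). split; [exact (ceer_discrete H HX)|].
  split; [exact (ceer_quasi_polish H HX)|exact (ceer_overt HX)].
Qed.
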